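(* Let $\mathfrak g$ be a compact simple Lie algebra with $\dim\mathfrak g\ge 8$. Then: (1) $\mathfrak g\otimes\mathfrak g^\perp=W_{har}\oplus\bigoplus_i V_i$, where each $V_i$ is an irreducible $\mathfrak g$-module isomorphic to an irreducible submodule of $\Lambda^2\mathfrak g\oplus\Lambda^4\mathfrak g$; (2) $W_{har}^\perp(D_+)$ contains a $\mathfrak g$-submodule isomorphic to $\mathfrak g^\perp$; (3) $W_{har}^\perp(D_-)$ contains a $\mathfrak g$-submodule isomorphic to $\Lambda^3_\delta(\mathfrak g)$; (4) the image of $D_+$ contains $\omega_{\mathfrak g}\wedge\Lambda^1(\mathfrak g)$; (5) $D_-:\mathfrak g\otimes\mathfrak g^\perp\to\Lambda^2\mathfrak g$ is surjective.
   Context: Standing conventions: $\mathfrak g$ compact simple real Lie algebra, $B$ its Killing form, $\langle\cdot,\cdot\rangle:=-B$ extended to $\Lambda^k\mathfrak g$, $\mathfrak g\cong\mathfrak g^*$ via $\langle,\rangle$; $\omega_{\mathfrak g}(X,Y,Z)=B(X,[Y,Z])$; $\mathfrak g^\perp:=\ker(\Lambda^2\mathfrak g\to\mathfrak g,\ v\wedge w\mapsto[v,w])$; $\mathfrak{so}(\mathfrak g)\cong\Lambda^2\mathfrak g$ via $v\wedge w\mapsto(x\mapsto\langle v,x\rangle w-\langle w,x\rangle v)$, and $\rho_*$ the induced derivation action on $\Lambda^k\mathfrak g$. $D_+:\mathfrak g\otimes\mathfrak g^\perp\to\Lambda^4\mathfrak g$, $v\otimes\tau\mapsto v\wedge\rho_*(\tau)(\omega_{\mathfrak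 g})$; $D_-:\mathfrak g\otimes\mathfrak g^\perp\to\Lambda^2\mathfrak g$, $v\otimes\tau\mapsto v\lrcorner\rho_*(\tau)(\omega_{\mathfrak g})$. $W_{har}:=\ker D_+\cap\ker D_-$, and $W_{har}^\perp(D_\pm)$ is the orthogonal complement of $W_{har}$ in $\ker D_\pm$. The differential $d_{\mathfrak g}:\Lambda^k\mathfrak g\to\Lambda^{k+1}\mathfrak g$ is defined on $\Lambda^1$ by $\langle d_{\mathfrak g}v,x\wedge y\rangle=\langle v,[x,y]\rangle$ and extended by $d_{\mathfrak g}(\alpha\wedge\phi)=d_{\mathfrak g}\alpha\wedge\phi+(-1)^{\deg\alpha}\alpha\wedge d_{\mathfrak g}\phi$; $\delta_{\mathfrak g}$ is its adjoint; $\Lambda^3_\delta(\mathfrak g):=\delta_{\mathfrak g}(\Lambda^4\mathfrak g)$. *)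

(* Defs.v *)
From HB Require Import structures.
From mathcomp Require Import all_boot all_order all_algebra all_fingroup.
Set Implicit Arguments. Unset Strict Implicit. Unset Printing Implicit Defensive.
Import Order.TTheory GRing.Theory Num.Theory.
Local Open Scope ring_scope.

(* Generic notions of g-modules: a module is an lmodType V together with *)
(* the action act i of the basis vector e_i of g (the action is linear in *)
(* X, so it is determined by the action of a basis).  Subsets are Prop    *)
(* predicates.                                                            *)
Section Modules.
Variables (R : ringType) (n : nat).

Definition subspace (V : lmodType R) (S : V -> Prop) : Prop :=
  S 0 /\ forall (a : R) x y, S x -> S y -> S (a *: x + y).

Definition submod (V : lmodType R) (act : 'I_n -> V -> V) (S : V -> Prop) :=
  subspace S /\ forall i x, S x -> S (act i x).

Definition irreducible (V : lmodType R) (act : 'I_n -> V -> V) (S : V -> Prop) :=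
  [/\ submod act S, (exists x, S x /\ x <> 0) &
      forall U : V -> Prop, submod act U -> (forall x, U x -> S x) ->
        (forall x, U x -> x = 0) \/ (forall x, S x -> U x)].

Definition gmod_iso (V W : lmodType R) (actV : 'I_n -> V -> V)
    (actW : 'I_n -> W -> W) (S : V -> Prop) (T : W -> Prop) :=
  exists f : V -> W,
    [/\ forall (a : R) x y, f (a *: x + y) = a *: f x + f y,
        forall x, S x -> T (f x),
        forall y, T y -> exists x, S x /\ f x = y,
        forall x, S x -> f x = 0 -> x = 0 &
        forall i x, S x -> f (actV i x) = actW i (f x)].
End Modules.

Section LieData.
Variables (R : rcfType) (n : nat).
(* structure constants w.r.t. a basis e_0..e_{n-1}:
   [e_i, e_j] = \sum_k c i j k e_k *)
Variable c : 'I_n -> 'I_n -> 'I_n -> R.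

Definition gvec := {ffun 'I_n -> R^o}.
Definition bracket (x y : gvec) : gvec :=
  [ffun m => \sum_i \sum_j x i * y j * c i j m].
Definition ebasis (a : 'I_n) : gvec := [ffun m => (m == a)%:R].

(* Killing form B(e_i,e_j) = tr(ad e_i ad e_j) *)
Definition killing_mx (i j : 'I_n) : R := \sum_a \sum_b c i b a * c j a b.
Definition killing (x y : gvec) : R :=
  \sum_i \sum_j x i * y j * killing_mx i j.

Definition is_lie_algebra :=
  (forall x y, bracket x y = - bracket y x) /\
  (forall x y z, bracket x (bracket y z) + bracket y (bracket z x)
                 + bracket z (bracket x y) = 0).
Definition is_compact := forall x : gvec, x <> 0 -> killing x x < 0.
Definition is_simple :=
  (exists x y, bracket x y <> 0) /\
  forall I : gvec -> Prop, subspace I ->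
    (forall x y, I y -> I (bracket x y)) ->
    (forall x, I x -> x = 0) \/ (forall x, I x).

Definition metric (i j : 'I_n) : R := - killing_mx i j.
Definition metric_inv (i j : 'I_n) : R :=
  invmx (\matrix_(a, b) metric a b) i j.

(* Lambda^k g, identified with alternating k-forms via <,>; an element is
   stored as its values on basis tuples (e_{t 0}, ..., e_{t (k-1)}) *)
Definition tup k := {ffun 'I_k -> 'I_n}.
Definition Tens k := {ffun tup k -> R^o}.

Definition alt k (A : Tens k) : Prop :=
  forall (s : 'S_k) (t : tup k), A [ffun i => t (s i)] = (-1) ^+ s * A t.

(* induced inner product on Lambda^k (= det of <,> on decomposables) *)
Definition ipk k (A B : Tens k) : R :=
  (k`!)%:R^-1 * \sum_(s : tup k) \sum_(t : tup k)
     A s * B t * \prod_(l < k) metric_inv (s l) (t l).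

Definition tcons k (a : 'I_n) (t : tup k) : tup k.+1 :=
  [ffun i => if unlift ord0 i is Some j then t j else a].
Definition tupd k (t : tup k) (l : 'I_k) (m : 'I_n) : tup k :=
  [ffun j => if j == l then m else t j].
Definition tup2 (a b : 'I_n) : tup 2 := tcons a (tcons b [ffun i => a]).

Definition wedge p q (A : Tens p) (B : Tens q) : Tens (p + q) :=
  [ffun t : tup (p + q) => (p`! * q`!)%:R^-1 * \sum_(s : 'S_(p + q))
     (-1) ^+ s * A [ffun i => t (s (lshift q i))]
               * B [ffun j => t (s (rshift p j))]].

Definition interior k (v : gvec) (A : Tens k.+1) : Tens k :=
  [ffun t : tup k => \sum_a v a * A (tcons a t)].

Definition flat (v : gvec) : Tens 1 :=
  [ffun t : tup 1 => \sum_a v a * metric a (t ord0)].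

(* rho_*(T) for T in so(g) (given by its matrix T m a = (T e_a)_m),
   acting as a derivation on Lambda^k *)
Definition rho k (T : 'I_n -> 'I_n -> R) (A : Tens k) : Tens k :=
  [ffun t : tup k => - \sum_(l < k) \sum_m T m (t l) * A (tupd t l m)].

(* so(g) = Lambda^2 g: tau |-> T_tau with <T_tau x, y> = tau(x,y), i.e.
   v /\ w |-> (x |-> <v,x> w - <w,x> v) *)
Definition so_of (tau : Tens 2) (m a : 'I_n) : R :=
  \sum_l metric_inv m l * tau (tup2 a l).

Definition adm (i : 'I_n) (m a : 'I_n) : R := c i a m.
Definition actk k (i : 'I_n) (A : Tens k) : Tens k := rho (adm i) A.

Definition omega : Tens 3 :=
  [ffun t : tup 3 => \sum_k c (t (inord 1)) (t (inord 2)) k * killing_mx (t (inord 0)) k].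

(* the bracket map Lambda^2 g -> g, v /\ w |-> [v,w]; tau is given as a
   form, its contravariant components are sum metric_inv metric_inv tau;
   an element sum_{i<j} tau^{ij} e_i /\ e_j maps to 1/2 sum tau^{ij}[e_i,e_j] *)
Definition bracket_map (tau : Tens 2) : gvec :=
  [ffun m => 2%:R^-1 * \sum_i \sum_j \sum_k \sum_l
     metric_inv i k * metric_inv j l * tau (tup2 k l) * c i j m].

Definition gperp (tau : Tens 2) : Prop := alt tau /\ bracket_map tau = 0.

(* differential d_g : Lambda^{k+1} -> Lambda^{k+2}, the derivation extending
   <d v, x /\ y> = <v,[x,y]> (in form language: (d theta)(x,y) = theta([x,y]));
   d A = Alt(Y) / (2 k!) with Y(j1,j2,s) = sum_m c j1 j2 m A(m,s). *)
Definition dg k (A : Tens k.+1) : Tens k.+2 :=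
  [ffun t : tup k.+2 => (2 * k`!)%:R^-1 * \sum_(s : 'S_k.+2) (-1) ^+ s *
     \sum_m c (t (s ord0)) (t (s (lift ord0 ord0))) m *
        A (tcons m [ffun i : 'I_k => t (s (lift ord0 (lift ord0 i)))])].

(* Lambda^3_delta = delta_g(Lambda^4), delta_g the adjoint of d_g *)
Definition Lambda3_delta (x : Tens 3) : Prop :=
  exists beta : Tens 4, [/\ alt beta, alt x &
    forall alpha : Tens 3, alt alpha -> ipk alpha x = ipk (dg alpha) beta].

(* g (x) Lambda^2 g: P (a, t) = component along e_a of the g-factor *)
Definition GT := {ffun ('I_n * tup 2) -> R^o}.
Definition slice (P : GT) (a : 'I_n) : Tens 2 := [ffun t => P (a, t)].

Definition ggperp (P : GT) : Prop := forall a, gperp (slice P a).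

Definition ipGT (P Q : GT) : R :=
  \sum_a \sum_b metric a b * ipk (slice P a) (slice Q b).

Definition actGT (i : 'I_n) (P : GT) : GT :=
  [ffun p => \sum_b c i b p.1 * P (b, p.2) + actk i (slice P p.1) p.2].

(* D_+ (v (x) tau) = v /\ rho_*(tau)(omega),
   D_- (v (x) tau) = v _| rho_*(tau)(omega), extended linearly *)
Definition Dplus (P : GT) : Tens 4 :=
  \sum_a wedge (flat (ebasis a)) (rho (so_of (slice P a)) omega).
Definition Dminus (P : GT) : Tens 2 :=
  \sum_a interior (ebasis a) (rho (so_of (slice P a)) omega).

Definition Whar (P : GT) : Prop := [/\ ggperp P, Dplus P = 0 & Dminus P = 0].
Definition WperpPlus (P : GT) : Prop :=
  [/\ ggperp P, Dplus P = 0 & forall w, Whar w -> ipGT P w = 0].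
Definition WperpMinus (P : GT) : Prop :=
  [/\ ggperp P, Dminus P = 0 & forall w, Whar w -> ipGT P w = 0].

Definition L24 := (Tens 2 * Tens 4)%type.
Definition inL24 (p : L24) : Prop := alt p.1 /\ alt p.2.
Definition act24 (i : 'I_n) (p : L24) : L24 := (actk i p.1, actk i p.2).

End LieData.

(* Main.v *)
(* Write i_a, L_a, d, delta for contraction, Lie derivative, the differential and
   its adjoint.  For tau in Lambda^2 one has rho_*(tau) omega = - d tau, while
   g^perp = ker delta, so D_+ (v (x) tau) = - v /\ d tau and
   D_- (v (x) tau) = - v _| d tau.  Everything then follows from
   i_a d + d i_a = - L_a, 2 d = - sum_a e^a /\ L_a, 2 delta = sum_a L_a i_a and
   d delta + delta d = - Cas / 2.
   (1) (D_-, D_+) is equivariant and injective on the complement of W_har, which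
   is completely reducible.
   (2) tau |-> sum_a e_a (x) L_a tau maps g^perp into ker D_+, is orthogonal to
   ker D_-, and D_- maps it back to Cas tau.
   (3) x |-> sum_a e_a (x) pi (i_a x), with pi the projection onto g^perp, maps
   Lambda^3_delta into ker D_-, and D_+ maps it to 2 d x, which determines x;
   projecting away W_har changes neither.
   (4) sum_a e_a (x) pi (e^a /\ theta) is mapped by D_+ to a multiple of
   omega /\ theta.
   (5) If beta is orthogonal to the image of D_-, then delta (e_a /\ beta) = 0,
   that is L_a beta = e_a /\ x with x = delta beta; the bracket relations of the
   L_a give (dim g - 3) L_a x = 0, hence x = 0, so beta is invariant and
   vanishes. *)
Require Import Defs.
From HB Require Import structures.
From mathcomp Require Import all_boot all_order all_algebra all_fingroup.
From mathcomp Require Import ring lra zify.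
From Stdlib Require Import Classical.
Import Order.TTheory GRing.Theory Num.Theory.
Set Implicit Arguments. Unset Strict Implicit. Unset Printing Implicit Defensive.
Local Open Scope ring_scope.

(** Sums over permutations occur only in the comparison with the given definitions. A tensor is
    determined by its contractions with basis vectors, so exterior multiplication and d are fixed by
    how they commute with contraction, and the operator identities become inductions on the degree.
    The constants come from the choice of -B as inner product: the Casimir operator is then -1 on g,
    so delta d = 1/2 on one-forms, and pi = 1 - 2 d delta. Nonvanishing rests on positivity. If A is
    orthogonal to Cas A, then A is invariant, and degrees 1 and 2 have no nonzero invariants; this
    serves (2) and (5). In degree 3 the form omega is itself invariant, so (3) uses instead that im
    delta meets ker d only in 0, which makes delta d injective on Lambda^3_delta. Surjectivity
    always follows by showing that nothing nonzero is orthogonal to the image. The factor dim g - 3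
    in (5) reflects a true exception: in dimension 3 the bracket identifies Lambda^2 g with g, so
    g^perp = 0. *)

(** * Subspaces given by predicates *)

Section SubspaceVspace.
Variables (F : fieldType) (V : vectType F).
Implicit Types S T : V -> Prop.

Lemma subspaceD S x y : subspace S -> S x -> S y -> S (x + y).
Proof. by move=> [_ h] Sx Sy; have := h 1 x y Sx Sy; rewrite scale1r. Qed.

Lemma subspaceZ S a x : subspace S -> S x -> S (a *: x).
Proof. by move=> [S0 h] Sx; have := h a x 0 Sx S0; rewrite addr0. Qed.

Lemma subspaceN S x : subspace S -> S x -> S (- x).
Proof. by move=> hS Sx; rewrite -scaleN1r; apply: subspaceZ. Qed.

Lemma subspaceB S x y : subspace S -> S x -> S y -> S (x - y).
Proof. by move=> hS Sx Sy; apply: subspaceD => //; apply: subspaceN. Qed.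

Lemma subspace_sum S (I : finType) (v : I -> V) :
  subspace S -> (forall i, S (v i)) -> S (\sum_i v i).
Proof.
move=> hS hv; apply: (big_ind S) => //; first by case: hS.
by move=> x y; apply: subspaceD.
Qed.

(** Among the [{vspace V}] contained in [S] take one of maximal dimension; adjoining the line of any
    further vector of [S] would contradict maximality. *)
Lemma subspace_vspace S : subspace S -> exists U : {vspace V}, forall x, S x <-> x \in U.
Proof.
move=> hS.
have: exists U : {vspace V}, (forall x, x \in U -> S x) /\
    forall U' : {vspace V}, (forall x, x \in U' -> S x) -> (\dim U' <= \dim U)%N.
  apply: NNPP => hN.
  (* Without a maximum the dimensions inside [S] would be unbounded, against [\dim {:V}]. *)
  have H k : exists U : {vspace V}, (forall x, x \in U -> S x) /\ (k <= \dim U)%N.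
    elim: k => [|k [U [US kU]]].
      by exists 0%VS; split=> // x; rewrite memv0 => /eqP->; case: hS.
    apply: NNPP => hk; apply: hN; exists U; split=> // U' U'S.
    rewrite leqNgt; apply/negP => ltUU'; apply: hk; exists U'; split=> //.
    exact: leq_ltn_trans ltUU'.
  have [U [_]] := H (\dim {:V}).+1.
  by rewrite ltnNge dimvS ?subvf.
move=> [U [US maxU]]; exists U => x; split=> [Sx|]; last exact: US.
have UxS y : y \in (U + <[x]>)%VS -> S y.
  move=> /memv_addP[u uU [z /vlineP[a ->] ->]].
  by apply: subspaceD => //; [apply: US | apply: subspaceZ].
have := maxU _ UxS => /(conj (addvSl U <[x]>%VS)) [sU dU].
have /eqP eU : U == (U + <[x]>)%VS by rewrite eqEdim sU.
by rewrite eU (subvP (addvSr U _)) // memv_line.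
Qed.

End SubspaceVspace.

(** * Orthogonal projection and complete reducibility *)

Section InnerProduct.
Variables (R : realFieldType) (V : vectType R) (b : V -> V -> R).
Hypothesis bC : forall x y, b x y = b y x.
Hypothesis b_lin : forall a x y z, b (a *: x + y) z = a * b x z + b y z.
Hypothesis b_gt0 : forall x, x != 0 -> 0 < b x x.
Implicit Types S T : V -> Prop.

Lemma form_0l x : b 0 x = 0.
Proof. by have := b_lin 1 0 0 x; rewrite scaler0 addr0 mul1r => h; lra. Qed.
Lemma form_Dl x y z : b (x + y) z = b x z + b y z.
Proof. by have := b_lin 1 x y z; rewrite scale1r mul1r. Qed.
Lemma form_Zl a x z : b (a *: x) z = a * b x z.
Proof. by have := b_lin a x 0 z; rewrite addr0 form_0l addr0. Qed.
Lemma form_Bl x y z : b (x - y) z = b x z - b y z.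
Proof. by rewrite form_Dl -scaleN1r form_Zl mulN1r. Qed.
Lemma form_Dr x y z : b x (y + z) = b x y + b x z.
Proof. by rewrite bC form_Dl !(bC x). Qed.
Lemma form_Zr a x y : b x (a *: y) = a * b x y.
Proof. by rewrite bC form_Zl bC. Qed.
Lemma form_eq0 x : b x x = 0 -> x = 0.
Proof. by move=> h; apply/eqP; apply: contraT => /b_gt0; rewrite h ltxx. Qed.

(** One Gram-Schmidt step per vector of [X]. *)
Lemma span_proj (X : seq V) x :
  exists2 s, s \in <<X>>%VS & forall t, t \in <<X>>%VS -> b (x - s) t = 0.
Proof.
elim: X x => [|v X IH] x.
  exists 0; first by rewrite mem0v.
  by move=> t; rewrite span_nil memv0 => /eqP->; rewrite bC form_0l.
have [sx sxX hx] := IH x; have [sv svX hv] := IH v.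
(* If [v] already lies in the span of [X], then [v'] is 0 and so is the correction [k *: v']; the
   case is separated at the end. *)
pose v' := v - sv; pose k := b (x - sx) v' / b v' v'.
have v'X : v' \in <<v :: X>>%VS.
  rewrite span_cons memvB //; last exact: (subvP (addvSr _ _)).
  by apply: (subvP (addvSl _ _)); apply: memv_line.
exists (sx + k *: v').
  by rewrite memvD // ?memvZ // span_cons (subvP (addvSr _ _)).
move=> t; rewrite span_cons => /memv_addP[_ /vlineP[a ->] [u uX ->]].
have -> : a *: v + u = a *: v' + (a *: sv + u).
  by rewrite /v' scalerBr addrA subrK.
have wX : a *: sv + u \in <<X>>%VS by rewrite memvD ?memvZ.
rewrite opprD addrA; move: (hx _ wX) (hv _ wX); rewrite {}/k -/v'.
move: (x - sx) (a *: sv + u) {wX} => y w hy hw; clearbody v'.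
rewrite form_Bl !form_Dr !form_Zl !form_Zr hy hw.
have [->|nz] := eqVneq v' 0; first by rewrite (bC y) !form_0l; lra.
by rewrite mulrCA divfK ?gt_eqF ?b_gt0 //; lra.
Qed.

Lemma subspace_proj S x : subspace S ->
  exists2 s, S s & forall t, S t -> b (x - s) t = 0.
Proof.
move=> /subspace_vspace[U hU]; have [s] := span_proj (vbasis U) x.
rewrite (span_basis (vbasisP U)) => sU hs; exists s; first exact/hU.
by move=> t /hU; apply: hs.
Qed.

(** The common form of the surjectivity arguments: [S] is the expected target and [T] the image. *)
Lemma subspace_full S T : subspace S -> subspace T -> (forall x, T x -> S x) ->
  (forall y, S y -> (forall t, T t -> b y t = 0) -> y = 0) -> forall y, S y -> T y.
Proof.
move=> hS hT TS h y Sy; have [s Ts hs] := subspace_proj y hT.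
suff /eqP : y - s = 0 by rewrite subr_eq0 => /eqP->.
by apply: h => //; apply: subspaceB => //; apply: TS.
Qed.

Variables (n : nat) (act : 'I_n -> V -> V).
Hypothesis act_inv : forall i x y, b (act i x) y = - b x (act i y).

Lemma submod_perp S T : submod act S -> submod act T ->
  submod act (fun x => S x /\ forall t, T t -> b x t = 0).
Proof.
move=> [hS aS] [hT aT]; split; first split.
- by split=> [|t _]; [case: hS | rewrite form_0l].
- move=> a x y [Sx hx] [Sy hy]; split=> [|t Tt]; first by case: hS => _; apply.
  by rewrite b_lin hx // hy // mulr0 addr0.
by move=> i x [Sx hx]; split=> [|t Tt]; [apply: aS | rewrite act_inv hx ?oppr0 //; apply: aT].
Qed.

(** Descent on the dimension: a nonzero module that is not irreducible has a nonzero proper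
    submodule. As modules are predicates, the bound [k] is imposed on every [{vspace V}]
    representing them. *)
Lemma submod_irreducible S : submod act S -> (exists x, S x /\ x <> 0) ->
  exists T, irreducible act T /\ forall x, T x -> S x.
Proof.
move=> hS nzS.
suff H k : forall T, submod act T -> (exists x, T x /\ x <> 0) ->
    (forall U : {vspace V}, (forall x, T x <-> x \in U) -> (\dim U <= k)%N) ->
    exists T', irreducible act T' /\ forall x, T' x -> T x.
  by apply: (H (\dim {:V})) => // U _; rewrite dimvS ?subvf.
elim: k => [|k IH] T hT [x [Tx xn0]] hd; have [U hU] := subspace_vspace hT.1.
  case: xn0; apply/eqP; rewrite -memv0.
  have /eqP <- : U == 0%VS by rewrite -dimv_eq0 -leqn0 hd.
  exact/hU.
have [|N] := classic (irreducible act T); first by exists T.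
have [T1 [hT1 T1T nz1 neq1]] : exists T1, [/\ submod act T1, (forall x, T1 x -> T x),
    (exists x, T1 x /\ x <> 0) & exists x, T x /\ ~ T1 x].
  apply: NNPP => hN; apply: N; split=> //; first by exists x.
  move=> T1 hT1 T1T; apply: NNPP => /not_or_and[h1 h2]; apply: hN; exists T1; split=> //.
    by have [y hy] := not_all_ex_not _ _ h1; exists y; apply: imply_to_and.
  by have [y hy] := not_all_ex_not _ _ h2; exists y; apply: imply_to_and.
have [|T2 [irr2 T2T]] := IH _ hT1 nz1; last by exists T2; split=> // y /T2T /T1T.
move=> U1 hU1; rewrite -ltnS (leq_trans _ (hd _ hU)) // ltn_neqAle.
have sU : (U1 <= U)%VS by apply/subvP => y /hU1 /T1T /hU.
rewrite dimvS // andbT; apply/negP => eqd.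
have /eqP eU : U1 == U by rewrite eqEdim sU (eqP eqd) /=.
by have [y [Ty nTy]] := neq1; apply: nTy; apply/hU1; rewrite eU; apply/hU.
Qed.

(** An irreducible submodule splits off, and its orthogonal complement, again a submodule of smaller
    dimension, is decomposed recursively. *)
Lemma submod_decomposition S : submod act S ->
  exists (m : nat) (W : 'I_m -> V -> Prop),
   [/\ forall i, irreducible act (W i) /\ (forall x, W i x -> S x),
       forall x, S x -> exists2 v : 'I_m -> V, (forall i, W i (v i)) & x = \sum_i v i &
       forall v : 'I_m -> V, (forall i, W i (v i)) -> \sum_i v i = 0 -> forall i, v i = 0].
Proof.
move=> hS0.
suff H k : forall S, submod act S ->
    (forall U : {vspace V}, (forall x, S x <-> x \in U) -> (\dim U <= k)%N) ->
  exists (m : nat) (W : 'I_m -> V -> Prop),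
   [/\ forall i, irreducible act (W i) /\ (forall x, W i x -> S x),
       forall x, S x -> exists2 v : 'I_m -> V, (forall i, W i (v i)) & x = \sum_i v i &
       forall v : 'I_m -> V, (forall i, W i (v i)) -> \sum_i v i = 0 -> forall i, v i = 0].
  by apply: (H (\dim {:V})) => // U _; rewrite dimvS ?subvf.
elim: k => {S hS0} [|k IH] S hS hd; have [U hU] := subspace_vspace hS.1.
all: have [nz|z] := classic (exists x, S x /\ x <> 0); last first.
1,3: exists 0%N, (fun i x => False); split=> [[]//|x Sx|v _ _ []//];
  exists (fun=> 0) => [[]//|]; rewrite big_ord0; apply: NNPP => hx; apply: z; by exists x.
- have [x [Sx []]] := nz; apply/eqP; rewrite -memv0.
  have /eqP <- : U == 0%VS by rewrite -dimv_eq0 -leqn0 hd.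
  exact/hU.
have [T [irrT TS]] := submod_irreducible hS nz.
have [hT [t0 [Tt0 t0n0]] _] := irrT.
have hP := submod_perp hS hT.
have [|m [W [irrW decW indW]]] := IH _ hP.
  move=> U' hU'; rewrite -ltnS (leq_trans _ (hd _ hU)) // ltn_neqAle.
  have sU : (U' <= U)%VS by apply/subvP => y /hU' [Sy _]; apply/hU.
  rewrite dimvS // andbT; apply/negP => eqd.
  have /eqP eU : U' == U by rewrite eqEdim sU (eqP eqd) /=.
  have [_ /(_ _ Tt0)/form_eq0] : S t0 /\ forall t, T t -> b t0 t = 0.
    by apply/hU'; rewrite eU; apply/hU/TS.
  by [].
exists m.+1, (fun i => if unlift ord0 i is Some j then W j else T); split.
- move=> i; case: unliftP => [j|] _ //=; have [irr WP] := irrW j; split=> // x /WP[] //.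
- move=> x Sx; have [s Ts hs] := subspace_proj x hT.1.
  have [|v Wv ev] := decW (x - s).
    by split=> //; apply: subspaceB => //; [case: hS | apply: TS].
  exists (fun i => if unlift ord0 i is Some j then v j else s).
    by move=> i; case: unliftP.
  rewrite big_ord_recl unlift_none; under eq_bigr do rewrite liftK.
  by rewrite -ev addrC subrK.
move=> v Wv; rewrite big_ord_recl => e0.
have Wv' j : W j (v (lift ord0 j)) by have := Wv (lift ord0 j); rewrite liftK.
have Tv : T (v ord0) by have := Wv ord0; rewrite unlift_none.
have [_ hperp] : S (\sum_j v (lift ord0 j)) /\
    forall t, T t -> b (\sum_j v (lift ord0 j)) t = 0.
  apply: (subspace_sum hP.1) => j; exact: (irrW j).2.
(* The remaining summands are orthogonal to [T], so pairing the relation with [v ord0] leaves only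
   its norm. *)
have v0 : v ord0 = 0.
  apply: form_eq0; have := form_0l (v ord0).
  by rewrite -e0 form_Dl hperp // addr0.
move: e0; rewrite v0 add0r => e0 i.
by case: (unliftP ord0 i) => [j ->|-> //]; apply: indW e0 j.
Qed.

End InnerProduct.

(** A submodule of the image is pulled back to [S]; injectivity and equivariance of [f] are required
    on [S] only. *)
Lemma irreducible_image (R : fieldType) (n : nat) (V W : vectType R)
    (actV : 'I_n -> V -> V) (actW : 'I_n -> W -> W) (S : V -> Prop) (f : V -> W) :
  (forall a x y, f (a *: x + y) = a *: f x + f y) ->
  (forall i x, S x -> f (actV i x) = actW i (f x)) ->
  (forall x, S x -> f x = 0 -> x = 0) ->
  irreducible actV S ->
  irreducible actW (fun y => exists2 x, S x & f x = y) /\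
  gmod_iso actV actW S (fun y => exists2 x, S x & f x = y).
Proof.
move=> f_lin f_act f_inj [[hS aS] [x0 [Sx0 x0n0]] irrS].
have f0 : f 0 = 0.
  have := f_lin (-1) 0 0; by rewrite addr0 scaler0 scaleN1r addNr.
split; last first.
  exists f; split=> //; first by move=> x Sx; exists x.
  by move=> y [x Sx <-]; exists x.
split.
- split; first split.
  + by exists 0; case: hS.
  + move=> a _ _ [x Sx <-] [y Sy <-]; exists (a *: x + y) => //; by case: hS => _; apply.
  + by move=> i _ [x Sx <-]; exists (actV i x); [apply: aS | apply: f_act].
- by exists (f x0); split; [exists x0 | move=> /(f_inj _ Sx0)].
move=> U [hU aU] US.
have hT : submod actV (fun x => S x /\ U (f x)).
  split; first split.
  - by split; [case: hS | rewrite f0; case: hU].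
  - move=> a x y [Sx Ux] [Sy Uy]; split; first by case: hS => _; apply.
    by rewrite f_lin; case: hU => _; apply.
  by move=> i x [Sx Ux]; split; [apply: aS | rewrite f_act //; apply: aU].
case: (irrS _ hT) => [x []//|h|h]; [left | right].
- by move=> y Uy; have [x Sx e] := US _ Uy; rewrite -e (h x) ?f0 // e.
by move=> _ [x Sx <-]; case: (h x Sx).
Qed.

(** Cholesky factorization by induction on the Schur complement of the upper left entry; the real
    closed field supplies the square root of the pivot. *)
Lemma posdef_factor (R : rcfType) n (G : 'M[R]_n) : G^T = G ->
  (forall x : 'rV_n, x != 0 -> 0 < (x *m G *m x^T) 0 0) ->
  exists2 Q, Q \in unitmx & G = Q *m Q^T.
Proof.
elim: n G => [|n IH] G symG posG.
  by exists 1%:M; rewrite ?unitmx1 // [LHS]flatmx0 [RHS]flatmx0.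
rewrite -[n.+1]/(1 + n)%N in G symG posG *.
pose a := G 0 0; pose b := ursubmx G; pose D := drsubmx G.
have eG : G = block_mx a%:M b b^T D.
  rewrite -[LHS]submxK -/b -/D; congr block_mx; first by rewrite [ulsubmx G]mx11_scalar !mxE lshift0.
  by rewrite /b -[in RHS]symG trmx_ursub trmxK.
have symD : D^T = D by rewrite /D trmx_drsub symG.
have a0 : 0 < a.
  have := posG (delta_mx 0 0); rewrite -rowE trmx_delta -colE.
  rewrite !mxE /a; apply; apply/eqP => /matrixP/(_ 0 0).
  by rewrite !mxE !eqxx => /eqP; rewrite oner_eq0.
have [||Q uQ eQ] := IH (D - a^-1 *: (b^T *m b)).
- by rewrite linearB linearZ /= trmx_mul trmxK symD.
(* This [x] minimizes the form of [G] over the vectors (x, y): the first block of the product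
   vanishes, and what remains is the Schur complement at [y]. *)
- move=> y y0; pose x : 'rV_1 := - a^-1 *: (y *m b^T).
  have := posG (row_mx x y); rewrite eG tr_row_mx mul_row_block mul_row_col.
  have -> : x *m a%:M + y *m b^T = 0.
    by rewrite /x mul_mx_scalar scalerA mulrN divff ?gt_eqF // scaleN1r addNr.
  rewrite mul0mx add0r mulmxBr -scalemxAr mulmxA.
  have -> : x *m b + y *m D = y *m D - a^-1 *: (y *m b^T *m b).
    by rewrite /x -scalemxAl scaleNr addrC.
  by apply; apply: contraNneq y0 => /eqP; rewrite row_mx_eq0 => /andP[].
have s0 : 0 < Num.sqrt a by rewrite sqrtr_gt0.
have ss : Num.sqrt a * Num.sqrt a = a by rewrite -expr2 sqr_sqrtr // ltW.
exists (block_mx (Num.sqrt a)%:M 0 ((Num.sqrt a)^-1 *: b^T) Q).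
  rewrite unitmxE det_lblock unitrM -!unitmxE uQ andbT.
  by rewrite unitmxE det_scalar1 unitfE gt_eqF.
rewrite eG tr_block_mx mulmx_block !trmx0 !mul0mx !mulmx0 !addr0.
rewrite tr_scalar_mx -scalar_mxM ss linearZ /= trmxK.
rewrite mul_scalar_mx mul_mx_scalar !scalerA divff ?gt_eqF // !scale1r.
by rewrite -scalemxAl -scalemxAr scalerA -invfM ss -eQ addrC subrK.
Qed.

(** Positivity of a tensor product of two inner products. With G = Q Q^T the double sum becomes a
    sum of squares of the vectors [u l], which cannot all vanish because [Q] is invertible. It
    yields positivity on Lambda^k, on g (x) Lambda^2 and for the Casimir operator. *)
Lemma posdef_sum (R : rcfType) n (G : 'M[R]_n) (V : lmodType R) (b : V -> V -> R) :
  (forall x y, b x y = b y x) ->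
  (forall a x y z, b (a *: x + y) z = a * b x z + b y z) ->
  (forall x, x != 0 -> 0 < b x x) ->
  G^T = G -> (forall x : 'rV_n, x != 0 -> 0 < (x *m G *m x^T) 0 0) ->
  forall v : 'I_n -> V, (exists i, v i != 0) ->
  0 < \sum_i \sum_j G i j * b (v i) (v j).
Proof.
move=> bC b_lin b_gt0 symG posG v [i0 vi0].
have [Q uQ eQ] := posdef_factor symG posG.
have b0 x : b 0 x = 0 by have := b_lin 1 0 0 x; rewrite scaler0 addr0 mul1r => h; lra.
have bsl (w : 'I_n -> V) (k : 'I_n -> R) y :
    b (\sum_i k i *: w i) y = \sum_i k i * b (w i) y.
  elim/big_rec2: _ => [|i u z _ <-]; first exact: b0.
  by rewrite b_lin.
have bsr (w : 'I_n -> V) (k : 'I_n -> R) y :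
    b y (\sum_i k i *: w i) = \sum_i k i * b y (w i).
  by rewrite bC bsl; apply: eq_bigr => i _; rewrite bC.
pose u l := \sum_i Q i l *: v i.
have -> : \sum_i \sum_j G i j * b (v i) (v j) = \sum_l b (u l) (u l).
  transitivity (\sum_i \sum_j \sum_l Q i l * (Q j l * b (v i) (v j))).
    apply: eq_bigr => i _; apply: eq_bigr => j _; rewrite eQ mxE mulr_suml.
    by apply: eq_bigr => l _; rewrite mxE mulrA.
  under eq_bigr do rewrite exchange_big.
  rewrite exchange_big; apply: eq_bigr => l _.
  rewrite bsl; apply: eq_bigr => i _; rewrite bsr mulr_sumr.
  by apply: eq_bigr.
have ge0 l : 0 <= b (u l) (u l).
  by have [->|/b_gt0/ltW//] := eqVneq (u l) 0; rewrite b0.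
rewrite lt0r sumr_ge0 // andbT psumr_eq0 //; apply: contraNN vi0 => /allP h.
have u0 l : u l = 0.
  apply/eqP; apply: contraT => /b_gt0; have := h l; rewrite mem_index_enum => /(_ isT) /=.
  by move=> /eqP->; rewrite ltxx.
apply/eqP; transitivity (\sum_l invmx Q l i0 *: u l); last first.
  by rewrite big1 // => l _; rewrite u0 scaler0.
under [RHS]eq_bigr do rewrite scaler_sumr.
rewrite exchange_big /=.
transitivity (\sum_i (1%:M : 'M[R]_n) i i0 *: v i).
  rewrite (bigD1 i0) //= mxE eqxx scale1r big1 ?addr0 // => i /negPf ne.
  by rewrite mxE ne scale0r.
apply: eq_bigr => i _; rewrite -(mulmxV uQ) mxE scaler_suml.
by apply: eq_bigr => l _; rewrite scalerA mulrC.
Qed.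

(** * Contraction, exterior multiplication, Lie derivative and differential on tensors *)

Section TensorOperations.
Variables (R : rcfType) (n : nat).
Local Notation T k := (Tens R n k).

Lemma tens_scaleE k a (A : T k) t : (a *: A) t = a * A t.
Proof. by rewrite ffunE. Qed.

Lemma tens_addE k (A B : T k) t : (A + B) t = A t + B t.
Proof. by rewrite ffunE. Qed.
Lemma tens_oppE k (A : T k) t : (- A) t = - A t.
Proof. by rewrite ffunE. Qed.
Lemma tens_zeroE k (t : tup n k) : (0 : T k) t = 0.
Proof. by rewrite ffunE. Qed.
Definition tensE := (tens_addE, tens_oppE, tens_scaleE, tens_zeroE).

End TensorOperations.

(* Linear identities between tensors, checked pointwise; convertible but
   syntactically different sums are first identified. *)
Ltac tensor_ring :=
  repeat match goal with |- context [@bigop.body ?A ?I ?i ?r ?F] =>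
    let z := fresh in set z := (@bigop.body A I i r F); clearbody z end;
  apply/ffunP => ?; rewrite !tensE; ring.

Section Tensors.
Variables (R : rcfType) (n : nat).
Local Notation T k := (Tens R n k).

Definition tbehead k (t : tup n k.+1) : tup n k := [ffun i => t (lift ord0 i)].

Lemma tcons0 k a (t : tup n k) : tcons a t ord0 = a.
Proof. by rewrite ffunE unlift_none. Qed.
Lemma tconsS k a (t : tup n k) i : tcons a t (lift ord0 i) = t i.
Proof. by rewrite ffunE liftK. Qed.
Lemma tconsK k a (t : tup n k) : tbehead (tcons a t) = t.
Proof. by apply/ffunP => i; rewrite ffunE tconsS. Qed.
Lemma tcons_eta k (t : tup n k.+1) : tcons (t ord0) (tbehead t) = t.
Proof. by apply/ffunP => i; rewrite ffunE; case: unliftP => [j ->|->]; rewrite ?ffunE. Qed.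

Lemma tup0_eq (s t : tup n 0) : s = t.
Proof. by apply/ffunP => -[]. Qed.

Lemma sum_tcons k (F : tup n k.+1 -> R) :
  \sum_t F t = \sum_a \sum_(t : tup n k) F (tcons a t).
Proof.
rewrite pair_bigA /= (reindex (fun p : 'I_n * tup n k => tcons p.1 p.2)) //=.
exists (fun t : tup n k.+1 => (t ord0, tbehead t)) => [[a t] _|t _] /=.
  by rewrite tcons0 tconsK.
exact: tcons_eta.
Qed.

(* The operators are sealed: unification would otherwise unfold them. *)
Fact form_key : unit. Proof. by []. Qed.
Definition inn k a : T k.+1 -> T k :=
  locked_with form_key (fun A => [ffun t : tup n k => A (tcons a t)]).

Lemma innE k a (A : T k.+1) t : inn a A t = A (tcons a t).
Proof. by rewrite /inn unlock ffunE. Qed.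

(** Assembles a tensor from prescribed contractions; the recursive operators below are defined
    through it. *)
Definition build k (F : 'I_n -> T k) : T k.+1 := [ffun t : tup n k.+1 => F (t ord0) (tbehead t)].

Lemma inn_build k (F : 'I_n -> T k) a : inn a (build F) = F a.
Proof. by apply/ffunP => t; rewrite innE [build F _]ffunE tcons0 tconsK. Qed.

(** The extensionality principle behind every induction on the degree. *)
Lemma inn_ext k (A B : T k.+1) : (forall a, inn a A = inn a B) -> A = B.
Proof.
move=> h; apply/ffunP => t; have /ffunP/(_ (tbehead t)) := h (t ord0).
by rewrite !innE tcons_eta.
Qed.

Fact inn_linear k a : linear (@inn k a).
Proof. by move=> x A B; apply/ffunP => t; rewrite !(innE, tensE). Qed.
HB.instance Definition _ k a := GRing.isLinear.Build R _ _ _ (@inn k a) (@inn_linear k a).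
Lemma innZ k x a (A : T k.+1) : inn x (a *: A) = a *: inn x A.
Proof. exact: linearZ. Qed.
Lemma innN k x (A : T k.+1) : inn x (- A) = - inn x A.
Proof. exact: linearN. Qed.
Lemma innD k x (A B : T k.+1) : inn x (A + B) = inn x A + inn x B.
Proof. exact: linearD. Qed.
Lemma innB k x (A B : T k.+1) : inn x (A - B) = inn x A - inn x B.
Proof. exact: linearB. Qed.
Lemma inn_sum (I : finType) k x (A : I -> T k.+1) : inn x (\sum_i A i) = \sum_i inn x (A i).
Proof. exact: linear_sum. Qed.

(* Exterior multiplication by a covector, specified by its commutation with
   [inn].  The recursion makes sense on all tensors, so that most operator
   identities need no alternation hypothesis; the same holds for [dif]. *)
Fixpoint wdg_rec k (f : 'I_n -> R) : T k -> T k.+1 :=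
  if k is k'.+1 return T k -> T k.+1
  then fun A => build (fun b => f b *: A - wdg_rec f (inn b A))
  else fun A => build (fun b => f b *: A).
Definition wdg k f : T k -> T k.+1 := locked_with form_key (@wdg_rec k f).

Lemma inn_wdg0 f (A : T 0) b : inn b (wdg f A) = f b *: A.
Proof. by rewrite /wdg; case: form_key; apply: inn_build. Qed.
Lemma inn_wdg k f (A : T k.+1) b : inn b (wdg f A) = f b *: A - wdg f (inn b A).
Proof. by rewrite /wdg; case: form_key; apply: inn_build. Qed.

Fact wdg_linear k f : linear (@wdg k f).
Proof.
elim: k => [|k IH] x A B; apply: inn_ext => b.
  by rewrite inn_linear !inn_wdg0 scalerDr !scalerA mulrC.
rewrite inn_linear !inn_wdg inn_linear IH scalerDr scalerBr !scalerA mulrC opprD.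
by rewrite addrACA.
Qed.
HB.instance Definition _ k f := GRing.isLinear.Build R _ _ _ (@wdg k f) (@wdg_linear k f).
Lemma wdgZ k f a (A : T k) : wdg f (a *: A) = a *: wdg f A.
Proof. exact: linearZ. Qed.
Lemma wdgN k f (A : T k) : wdg f (- A) = - wdg f A.
Proof. exact: linearN. Qed.
Lemma wdgD k f (A B : T k) : wdg f (A + B) = wdg f A + wdg f B.
Proof. exact: linearD. Qed.
Lemma wdgB k f (A B : T k) : wdg f (A - B) = wdg f A - wdg f B.
Proof. exact: linearB. Qed.
Lemma wdg_sum (I : finType) k f (A : I -> T k) : wdg f (\sum_i A i) = \sum_i wdg f (A i).
Proof. exact: linear_sum. Qed.

Lemma wdg_eql k f g (A : T k) : f =1 g -> wdg f A = wdg g A.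
Proof.
move=> fg; elim: k A => [|k IH] A; apply: inn_ext => b; first by rewrite !inn_wdg0 fg.
by rewrite !inn_wdg fg IH.
Qed.

Lemma wdg_suml (I : finType) k (f : I -> 'I_n -> R) (A : T k) (a : I -> R) :
  wdg (fun x => \sum_i a i * f i x) A = \sum_i a i *: wdg (f i) A.
Proof.
elim: k A => [|k IH] A; apply: inn_ext => b; rewrite inn_sum.
  rewrite inn_wdg0 scaler_suml; apply: eq_bigr => i _.
  by rewrite innZ inn_wdg0 scalerA.
rewrite inn_wdg IH scaler_suml -sumrB; apply: eq_bigr => i _.
by rewrite innZ inn_wdg scalerBr scalerA.
Qed.

Lemma wdgC k f g (A : T k) : wdg f (wdg g A) = - wdg g (wdg f A).
Proof.
elim: k A => [|k IH] A; apply: inn_ext => b; rewrite innN.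
  by rewrite !(inn_wdg _ (wdg _ _)) !inn_wdg0 !wdgZ opprB.
rewrite !(inn_wdg _ (wdg _ _)) !inn_wdg !wdgB !wdgZ IH. tensor_ring.
Qed.

Lemma wdg_opp k f (A : T k) : wdg (fun x => - f x) A = - wdg f A.
Proof.
elim: k A => [|k IH] A; apply: inn_ext => b; rewrite innN.
  by rewrite !inn_wdg0 scaleNr.
by rewrite !inn_wdg scaleNr IH opprD.
Qed.

Section Action.
Variable c : 'I_n -> 'I_n -> 'I_n -> R.
Definition lact k a : T k -> T k := locked_with form_key (@actk R n c k a).

Lemma lact_actk k a (A : T k) : lact a A = actk c a A.
Proof. by rewrite /lact unlock. Qed.

Lemma lactE k a (A : T k) t :
  lact a A t = - \sum_(l < k) \sum_m c a (t l) m * A (tupd t l m).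
Proof. by rewrite lact_actk ffunE. Qed.

Lemma lact0E a (A : T 0) : lact a A = 0.
Proof. by apply/ffunP => t; rewrite lactE big_ord0 oppr0 ffunE. Qed.

Lemma tupd_tcons0 k b (t : tup n k) m : tupd (tcons b t) ord0 m = tcons m t.
Proof. by apply/ffunP => i; rewrite !ffunE; case: unliftP => [j ->|->]. Qed.
Lemma tupd_tconsS k b (t : tup n k) l m :
  tupd (tcons b t) (lift ord0 l) m = tcons b (tupd t l m).
Proof.
apply/ffunP => i; rewrite ffunE; case: (unliftP ord0 i) => [j ->|->].
  by rewrite (inj_eq lift_inj) !tconsS ffunE.
by rewrite !tcons0.
Qed.

(** The commutator of L_a and i_b is the contraction with [e_a, e_b]: the slot filled by e_b is the
    only one that L_a treats differently on the two sides. *)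
Lemma inn_lact k a b (A : T k.+1) :
  inn b (lact a A) = lact a (inn b A) - \sum_m c a b m *: inn m A.
Proof.
apply/ffunP => t; rewrite tens_addE tens_oppE sum_ffunE innE !lactE big_ord_recl opprD addrC; congr (_ - _).
  congr (- _); apply: eq_bigr => l _; apply: eq_bigr => m _.
  by rewrite tconsS tupd_tconsS innE.
by apply: eq_bigr => m _; rewrite tcons0 tupd_tcons0 tens_scaleE innE.
Qed.

Fact lact_linear k a : linear (@lact k a).
Proof.
move=> x A B; apply/ffunP => t; rewrite tens_addE tens_scaleE !lactE mulrN mulr_sumr -opprD -big_split /=.
congr (- _); apply: eq_bigr => l _; rewrite mulr_sumr -big_split /=.
by apply: eq_bigr => m _; rewrite tens_addE tens_scaleE mulrDr mulrCA.
Qed.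
HB.instance Definition _ k a := GRing.isLinear.Build R _ _ _ (@lact k a) (@lact_linear k a).
Lemma lactZ k x a (A : T k) : lact x (a *: A) = a *: lact x A.
Proof. exact: linearZ. Qed.
Lemma lactN k x (A : T k) : lact x (- A) = - lact x A.
Proof. exact: linearN. Qed.
Lemma lactD k x (A B : T k) : lact x (A + B) = lact x A + lact x B.
Proof. exact: linearD. Qed.
Lemma lactB k x (A B : T k) : lact x (A - B) = lact x A - lact x B.
Proof. exact: linearB. Qed.
Lemma lact_sum (I : finType) k x (A : I -> T k) : lact x (\sum_i A i) = \sum_i lact x (A i).
Proof. exact: linear_sum. Qed.

(* Cartan's formula [i_b d + d i_b = - L_b]; the sign is opposite to the
   Chevalley-Eilenberg one because [(d theta)(x, y) = theta [x, y]]. *)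
Fixpoint dif_rec k : T k -> T k.+1 :=
  if k is k'.+1 return T k -> T k.+1
  then fun A => build (fun b => - lact b A - dif_rec (inn b A))
  else fun A => 0.
Definition dif k : T k -> T k.+1 := locked_with form_key (@dif_rec k).

Lemma inn_dif k (A : T k.+1) b : inn b (dif A) = - lact b A - dif (inn b A).
Proof. by rewrite /dif; case: form_key; apply: inn_build. Qed.

Lemma dif0 (A : T 0) : dif A = 0.
Proof. by rewrite /dif; case: form_key. Qed.

Fact dif_linear k : linear (@dif k).
Proof.
elim: k => [|k IH] x A B; first by rewrite !dif0 scaler0 addr0.
apply: inn_ext => b; rewrite inn_linear !inn_dif lact_linear inn_linear IH scalerBr scalerN !opprD.
by rewrite addrACA.
Qed.
HB.instance Definition _ k := GRing.isLinear.Build R _ _ _ (@dif k) (@dif_linear k).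
Lemma difZ k a (A : T k) : dif (a *: A) = a *: dif A.
Proof. exact: linearZ. Qed.
Lemma difN k (A : T k) : dif (- A) = - dif A.
Proof. exact: linearN. Qed.
Lemma difD k (A B : T k) : dif (A + B) = dif A + dif B.
Proof. exact: linearD. Qed.
Lemma difB k (A B : T k) : dif (A - B) = dif A - dif B.
Proof. exact: linearB. Qed.
Lemma dif_sum (I : finType) k (A : I -> T k) : dif (\sum_i A i) = \sum_i dif (A i).
Proof. exact: linear_sum. Qed.

(** The coadjoint action of e_a on the covector [f], that is x |-> -f([e_a, x]). *)
Definition coact a (f : 'I_n -> R) : 'I_n -> R := fun x => - \sum_m c a x m * f m.

Lemma coactE k a f (B : T k) b :
  \sum_m c a b m *: (f m *: B) = - (coact a f b *: B).
Proof. by rewrite scaleNr opprK scaler_suml; apply: eq_bigr => m _; rewrite scalerA. Qed.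

Lemma lact_wdg k a f (A : T k) :
  lact a (wdg f A) = wdg f (lact a A) + wdg (coact a f) A.
Proof.
elim: k A => [|k IH] A; apply: inn_ext => b; rewrite inn_lact innD.
  rewrite !inn_wdg0 !lact0E scaler0; under eq_bigr do rewrite inn_wdg0.
  by rewrite coactE opprK.
under eq_bigr do rewrite inn_wdg scalerBr.
rewrite sumrB coactE !inn_wdg lactB lactZ IH inn_lact wdgB wdg_sum.
rewrite (eq_bigr _ (fun m _ => wdgZ f (c a b m) (inn m A))).
tensor_ring.
Qed.

End Action.
End Tensors.

(** * Structure constants, Killing form and invariance of the metric *)

Section LieStructure.
Variables (R : rcfType) (n : nat) (c : 'I_n -> 'I_n -> 'I_n -> R).
Hypotheses (hlie : is_lie_algebra c) (hcompact : is_compact c).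
Local Notation gm := (metric c).
Local Notation gi := (metric_inv c).

Lemma sum_delta (i : 'I_n) (F : 'I_n -> R) : \sum_j (j == i)%:R * F j = F i.
Proof.
rewrite (bigD1 i) //= eqxx mul1r big1 ?addr0 // => j /negPf ->; exact: mul0r.
Qed.

Lemma bracket_basis_l i (x : gvec R n) m :
  bracket c (ebasis R i) x m = \sum_j x j * c i j m.
Proof.
rewrite ffunE; transitivity (\sum_k (k == i)%:R * \sum_j x j * c k j m).
  by apply: eq_bigr => k _; rewrite mulr_sumr; apply: eq_bigr => j _; rewrite ffunE mulrA.
exact: sum_delta.
Qed.

Lemma bracket_basis i j m : bracket c (ebasis R i) (ebasis R j) m = c i j m.
Proof.
rewrite bracket_basis_l -[RHS](sum_delta j (fun k => c i k m)).
by apply: eq_bigr => k _; rewrite ffunE.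
Qed.

Lemma c_skew i j m : c i j m = - c j i m.
Proof. by rewrite -!bracket_basis hlie.1 ffunE. Qed.

Lemma bracket_bracket a b x p :
  bracket c (ebasis R a) (bracket c (ebasis R b) (ebasis R x)) p =
  \sum_m c b x m * c a m p.
Proof. by rewrite bracket_basis_l; apply: eq_bigr => m _; rewrite bracket_basis. Qed.

Lemma c_jacobi a b x p :
  \sum_m c b x m * c a m p - \sum_m c a x m * c b m p = \sum_m c a b m * c m x p.
Proof.
have /ffunP/(_ p) := hlie.2 (ebasis R a) (ebasis R b) (ebasis R x).
rewrite ffunE [X in X + _]ffunE !bracket_bracket ffunE.
have -> : \sum_m c x a m * c b m p = - \sum_m c a x m * c b m p.
  by rewrite -sumrN; apply: eq_bigr => m _; rewrite c_skew mulNr.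
have -> : \sum_m c a b m * c x m p = - \sum_m c a b m * c m x p.
  by rewrite -sumrN; apply: eq_bigr => m _; rewrite [c x m p]c_skew mulrN.
move=> e; lra.
Qed.

Definition admx a : 'M[R]_n := \matrix_(i, j) c a j i.
Definition gmx : 'M[R]_n := \matrix_(i, j) gm i j.

Lemma killingE i j : killing_mx c i j = \tr (admx i *m admx j).
Proof.
by apply: eq_bigr => a _; rewrite mxE; apply: eq_bigr => b _; rewrite !mxE.
Qed.

Lemma admx_bracket a b : \sum_m c a b m *: admx m = admx a *m admx b - admx b *m admx a.
Proof.
apply/matrixP => p x; rewrite summxE !mxE -[RHS]/(_ - _).
rewrite (eq_bigr (fun m => c a b m * c m x p)) => [|m _]; last by rewrite !mxE.
rewrite -c_jacobi; congr (_ - _); apply: eq_bigr => m _; rewrite !mxE mulrC //.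
Qed.

(** Both sums are traces of a commutator of adjoint matrices times a third one, and they cancel by
    cyclicity of the trace. *)
Lemma killing_inv a b d :
  \sum_m c a b m * killing_mx c m d + \sum_m c a d m * killing_mx c b m = 0.
Proof.
have -> : \sum_m c a b m * killing_mx c m d = \tr ((\sum_m c a b m *: admx m) *m admx d).
  by rewrite mulmx_suml linear_sum /=; apply: eq_bigr => m _; rewrite killingE -scalemxAl linearZ.
have -> : \sum_m c a d m * killing_mx c b m = \tr (admx b *m \sum_m c a d m *: admx m).
  by rewrite mulmx_sumr linear_sum /=; apply: eq_bigr => m _; rewrite killingE -scalemxAr linearZ.
rewrite !admx_bracket mulmxBl mulmxBr !linearB /= !mulmxA.
by rewrite [X in _ + (_ - X)]mxtrace_mulC mulmxA; lra.
Qed.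

Lemma gm_sym i j : gm i j = gm j i.
Proof. by rewrite /metric !killingE mxtrace_mulC. Qed.

Lemma gm_inv a b d : \sum_m c a b m * gm m d + \sum_m c a d m * gm b m = 0.
Proof.
rewrite -[RHS]oppr0 -[in RHS](killing_inv a b d) opprD -!sumrN.
by congr (_ + _); apply: eq_bigr => m _; rewrite /metric mulrN.
Qed.

Lemma gmx_sym : gmx^T = gmx.
Proof. by apply/matrixP => i j; rewrite !mxE gm_sym. Qed.

Lemma quad_formE (G : 'M[R]_n) (x : 'rV_n) :
  (x *m G *m x^T) 0 0 = \sum_i \sum_j x 0 i * x 0 j * G i j.
Proof.
rewrite mxE exchange_big; apply: eq_bigr => j _; rewrite mxE mulr_suml.
by apply: eq_bigr => i _; rewrite !mxE; ring.
Qed.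

Lemma gmx_posdef (x : 'rV_n) : x != 0 -> 0 < (x *m gmx *m x^T) 0 0.
Proof.
move=> x0; pose v : gvec R n := [ffun i => x 0 i].
have /hcompact : v <> 0.
  move=> /ffunP v0; case/eqP: x0; apply/rowP => i; have := v0 i.
  by rewrite !ffunE mxE.
rewrite quad_formE -oppr_gt0 /killing -sumrN; congr (_ < _).
apply: eq_bigr => i _; rewrite -sumrN; apply: eq_bigr => j _.
by rewrite !ffunE mxE /metric mulrN.
Qed.

Lemma gmx_unit : gmx \in unitmx.
Proof.
have [Q uQ ->] := posdef_factor gmx_sym gmx_posdef.
by rewrite unitmx_mul uQ unitmx_tr.
Qed.

Lemma giE i j : gi i j = invmx gmx i j. Proof. by []. Qed.

Lemma gmxV_sym : (invmx gmx)^T = invmx gmx.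
Proof. by rewrite trmx_inv gmx_sym. Qed.

Lemma gi_sym i j : gi i j = gi j i.
Proof. by rewrite !giE -[in LHS]gmxV_sym mxE. Qed.

Lemma gmxV_posdef (x : 'rV_n) : x != 0 -> 0 < (x *m invmx gmx *m x^T) 0 0.
Proof.
move=> x0; have -> : x *m invmx gmx *m x^T =
  (x *m invmx gmx) *m gmx *m (x *m invmx gmx)^T.
  by rewrite trmx_mul gmxV_sym mulmxKV ?gmx_unit // mulmxA.
apply: gmx_posdef; apply: contraNneq x0 => h.
by rewrite -(mulmxKV gmx_unit x) h mul0mx.
Qed.

Lemma gm_gi a d : \sum_b gm a b * gi b d = (a == d)%:R.
Proof.
have /matrixP/(_ a d) := mulmxV gmx_unit; rewrite !mxE => <-.
by apply: eq_bigr => b _; rewrite mxE.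
Qed.

Lemma gi_gm a d : \sum_b gi a b * gm b d = (a == d)%:R.
Proof. by rewrite eq_sym -gm_gi; apply: eq_bigr => b _; rewrite mulrC gm_sym gi_sym. Qed.

(** The adjoint matrices are skew for the metric; multiplying that identity by the inverse metric on
    both sides gives skewness for the inverse. *)
Lemma gi_inv a b d : \sum_m c a m b * gi m d + \sum_m c a m d * gi b m = 0.
Proof.
have h : (admx a)^T *m gmx = - (gmx *m admx a).
  apply/eqP; rewrite -addr_eq0; apply/eqP/matrixP => x y; rewrite !mxE.
  rewrite -[RHS](gm_inv a x y); congr (_ + _); apply: eq_bigr => m _; rewrite !mxE //.
  by rewrite mulrC.
have : admx a *m invmx gmx + invmx gmx *m (admx a)^T = 0.
  rewrite -[X in _ + X](mulmxK gmx_unit) -(mulmxA (invmx gmx)) h mulmxN mulmxA mulVmx ?gmx_unit //.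
  by rewrite mul1mx mulNmx subrr.
move=> /matrixP/(_ b d); rewrite !mxE => h0; rewrite -[RHS]h0; congr (_ + _); apply: eq_bigr => m _.
  by rewrite mxE.
by rewrite !mxE mulrC.
Qed.

(** Invariance of the inverse metric in the form used later: inside a contraction, ad e_x passes
    from one index to the other with a change of sign. *)
Lemma gi_contract (V : lmodType R) x (F : 'I_n -> 'I_n -> V) :
  \sum_a \sum_b gi a b *: (\sum_m c x a m *: F m b) =
  - \sum_a \sum_b gi a b *: (\sum_m c x b m *: F a m).
Proof.
apply/eqP; rewrite -addr_eq0; apply/eqP.
transitivity (\sum_m \sum_b (\sum_a c x a m * gi a b + \sum_a c x a b * gi m a) *: F m b);
  last first.
  by rewrite big1 // => m _; rewrite big1 // => b _; rewrite gi_inv scale0r.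
under [RHS]eq_bigr do under eq_bigr do rewrite scalerDl !scaler_suml.
under [RHS]eq_bigr do rewrite big_split; rewrite [RHS]big_split /=; congr (_ + _).
  under eq_bigr do under eq_bigr do rewrite scaler_sumr.
  under eq_bigr do rewrite exchange_big.
  rewrite exchange_big; apply: eq_bigr => m _; rewrite exchange_big /=.
  by apply: eq_bigr => b _; apply: eq_bigr => a _; rewrite scalerA mulrC.
apply: eq_bigr => a _; under eq_bigr do rewrite scaler_sumr.
rewrite exchange_big /=; apply: eq_bigr => m _; apply: eq_bigr => b _.
by rewrite scalerA mulrC.
Qed.

End LieStructure.

(** * Alternating tensors *)

Section Alternating.
Variables (R : rcfType) (n : nat).
Local Notation T k := (Tens R n k).

Lemma alt_deg0 (A : T 0) : alt A.
Proof.
move=> s t; have -> : s = 1%g by apply/permP => -[].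
rewrite odd_perm1 expr0 mul1r; congr (A _); exact: tup0_eq.
Qed.

Lemma alt_deg1 (A : T 1) : alt A.
Proof.
move=> s t; have -> : s = 1%g by apply/permP => i; rewrite !ord1.
rewrite odd_perm1 expr0 mul1r; congr (A _); apply/ffunP => i.
by rewrite ffunE perm1.
Qed.

Lemma alt_subspace k : subspace (@alt R n k).
Proof.
split=> [|x A B hA hB] s t; first by rewrite !ffunE mulr0.
by rewrite !tens_addE !tens_scaleE (hA s t) (hB s t) mulrDr mulrCA.
Qed.

Lemma tcons_lift_perm k a (t : tup n k) (s : 'S_k) :
  [ffun i => tcons a t (lift_perm ord0 ord0 s i)] = tcons a [ffun i => t (s i)].
Proof.
apply/ffunP => i; rewrite ffunE; case: (unliftP ord0 i) => [j ->|->].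
  by rewrite lift_perm_lift !tconsS ffunE.
by rewrite lift_perm_id !tcons0.
Qed.

Lemma alt_inn k a (A : T k.+1) : alt A -> alt (inn a A).
Proof.
move=> hA s t; rewrite !innE -tcons_lift_perm hA odd_lift_perm.
by [].
Qed.

Lemma alt_innC k a b (A : T k.+2) : alt A -> inn a (inn b A) = - inn b (inn a A).
Proof.
move=> hA; apply/ffunP => t; rewrite tens_oppE !innE.
pose i1 : 'I_k.+2 := lift ord0 ord0.
have := hA (tperm ord0 i1) (tcons a (tcons b t)).
rewrite odd_tperm expr1 mulN1r => <-; congr (A _); apply/ffunP => i.
rewrite [in RHS]ffunE; case: tpermP => [->|->|/eqP i0 /eqP ii].
- by rewrite tcons0 tconsS tcons0.
- by rewrite tconsS !tcons0.
case: (unliftP ord0 i) i0 ii => [j ->|-> //] _; rewrite !tconsS (inj_eq lift_inj).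
by case: (unliftP ord0 j) => [l ->|->] //; rewrite !tconsS.
Qed.

(** The first hypothesis covers the permutations fixing the first slot, the second one the
    transposition of the first two slots; together these generate the symmetric group. *)
Lemma alt_intro k (A : T k.+2) : (forall a, alt (inn a A)) ->
  (forall a b, inn a (inn b A) = - inn b (inn a A)) -> alt A.
Proof.
move=> h1 h2.
pose P (s : 'S_k.+2) := forall t : tup n k.+2, A [ffun i => t (s i)] = (-1) ^+ s * A t.
have PM s1 s2 : P s1 -> P s2 -> P (s1 * s2)%g.
  move=> P1 P2 t; have := P1 [ffun i => t (s2 i)]; rewrite P2 odd_permM signr_addb -mulrA => <-.
  by congr (A _); apply/ffunP => i; rewrite !ffunE permM.
have Pfix s : P (lift_perm ord0 ord0 s).
  move=> t; rewrite -(tcons_eta t) tcons_lift_perm odd_lift_perm -!innE h1.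
  by [].
have P01 : P (tperm ord0 (lift ord0 ord0)).
  move=> t; rewrite odd_tperm /= expr1 mulN1r -(tcons_eta t) -(tcons_eta (tbehead t)).
  move: (t ord0) (tbehead t ord0) (tbehead (tbehead t)) => a b u.
  have := congr1 (fun B : T k => B u) (h2 a b); rewrite tens_oppE !innE => <-.
  congr (A _); apply/ffunP => i; rewrite ffunE; case: tpermP => [->|->|/eqP i0 /eqP ii].
  - by rewrite tconsS !tcons0.
  - by rewrite tcons0 tconsS tcons0.
  case: (unliftP ord0 i) i0 ii => [j ->|-> //] _; rewrite !tconsS (inj_eq lift_inj).
  by case: (unliftP ord0 j) => [l ->|->] //; rewrite !tconsS.
have Pfix0 (s : 'S_k.+2) : s ord0 = ord0 -> P s.
  (* Restriction of [s] to the other slots. Since [s] fixes [ord0], the [unlift] always succeeds and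
     the default of [odflt] is never taken. *)
  move=> s0; have inj : injective (fun j => odflt ord0 (unlift ord0 (s (lift ord0 j)))).
    have hl j : exists l, s (lift ord0 j) = lift ord0 l.
      case: (unliftP ord0 (s (lift ord0 j))) => [l ->|]; first by exists l.
      by rewrite -[RHS]s0 => /perm_inj /esym/eqP; rewrite (negPf (neq_lift _ _)).
    move=> j1 j2; have [l1 e1] := hl j1; have [l2 e2] := hl j2.
    rewrite e1 e2 !liftK /= => e; apply: (@lift_inj _ ord0); apply: (@perm_inj _ s).
    by rewrite e1 e2 e.
  suff -> : s = lift_perm ord0 ord0 (perm inj) by apply: Pfix.
  apply/permP => i; case: (unliftP ord0 i) => [j ->|->]; last by rewrite lift_perm_id.
  rewrite lift_perm_lift permE; case: (unliftP ord0 (s (lift ord0 j))) => [l -> //|].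
  by rewrite -[RHS]s0 => /perm_inj /esym/eqP; rewrite (negPf (neq_lift _ _)).
have P0 j : P (tperm ord0 j).
  case: (unliftP ord0 j) => [l ->|->]; last by rewrite tperm1; apply: Pfix0; rewrite perm1.
  have [->|ne] := eqVneq l ord0; first exact: P01.
  (* Any transposition with 0 is the conjugate of (0 1) by a transposition that fixes 0. *)
  have -> : tperm ord0 (lift ord0 l) = (tperm ord0 (lift ord0 ord0) ^ tperm (lift ord0 ord0) (lift ord0 l))%g.
    by rewrite tpermJ tpermL tpermD // 1?eq_sym ?neq_lift // (inj_eq lift_inj).
  have Pt : P (tperm (lift ord0 ord0) (lift ord0 l)).
    by apply: Pfix0; rewrite tpermD // eq_sym neq_lift.
  by rewrite /conjg tpermV; exact: (PM _ _ Pt (PM _ _ P01 Pt)).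
(* Composing [s] with the transposition of 0 and [s ord0] gives a permutation fixing 0. *)
move=> s; have -> : s = ((s * tperm ord0 (s ord0)) * tperm ord0 (s ord0))%g.
  by rewrite -mulgA tperm2 mulg1.
apply: PM => //; apply: Pfix0; by rewrite permM tpermR.
Qed.

Lemma altD k (A B : T k) : alt A -> alt B -> alt (A + B).
Proof. exact: subspaceD (alt_subspace k). Qed.
Lemma altN k (A : T k) : alt A -> alt (- A).
Proof. exact: subspaceN (alt_subspace k). Qed.
Lemma altB k (A B : T k) : alt A -> alt B -> alt (A - B).
Proof. exact: subspaceB (alt_subspace k). Qed.
Lemma altZ k a (A : T k) : alt A -> alt (a *: A).
Proof. exact: subspaceZ (alt_subspace k). Qed.
Lemma alt_sum (I : finType) k (A : I -> T k) : (forall i, alt (A i)) -> alt (\sum_i A i).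
Proof. exact: subspace_sum (alt_subspace k). Qed.

Lemma alt_wdg k f (A : T k) : alt A -> alt (wdg f A).
Proof.
elim: k A => [|k IH] A hA; first exact: alt_deg1.
apply: alt_intro => [a|a b]; rewrite !inn_wdg.
  by apply: altB; [apply: altZ | apply: IH; apply: alt_inn].
rewrite !innB !innZ; case: k IH A hA => [|k] IH A hA.
  by rewrite !inn_wdg0; tensor_ring.
by rewrite !inn_wdg (alt_innC a b hA) wdgN; tensor_ring.
Qed.

End Alternating.

(** * The differential, its adjoint and the Casimir operator *)

Section Calculus.
Variables (R : rcfType) (n : nat) (c : 'I_n -> 'I_n -> 'I_n -> R).
Hypotheses (hlie : is_lie_algebra c) (hcompact : is_compact c).
Local Notation gm := (metric c).
Local Notation gi := (metric_inv c).
Local Notation T k := (Tens R n k).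

Lemma lact0 k a : lact c a (0 : T k) = 0. Proof. exact: linear0. Qed.
Lemma inn0 k a : inn a (0 : T k.+1) = 0. Proof. exact: linear0. Qed.
Lemma wdg0 k f : wdg f (0 : T k) = 0. Proof. exact: linear0. Qed.
Lemma difr0 k : dif c (0 : T k) = 0. Proof. exact: linear0. Qed.

Lemma scaler_sum2 (V : lmodType R) (u : 'I_n -> R) (v : 'I_n -> 'I_n -> R) (F : 'I_n -> V) :
  \sum_m u m *: (\sum_p v m p *: F p) = \sum_p (\sum_m u m * v m p) *: F p.
Proof.
under eq_bigr do rewrite scaler_sumr; rewrite exchange_big; apply: eq_bigr => p _ /=.
by rewrite scaler_suml; apply: eq_bigr => m _; rewrite scalerA.
Qed.

Lemma lact_inn k a b (A : T k.+1) :
  lact c a (inn b A) = inn b (lact c a A) + \sum_m c a b m *: inn m A.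
Proof. by rewrite inn_lact subrK. Qed.

Lemma inn_lact_lact k a b x (A : T k.+1) :
  inn x (lact c a (lact c b A)) = lact c a (lact c b (inn x A))
    - \sum_m c b x m *: lact c a (inn m A) - \sum_m c a x m *: lact c b (inn m A)
    + \sum_p (\sum_m c a x m * c b m p) *: inn p A.
Proof.
rewrite inn_lact [inn x (lact c b A)]inn_lact lactB lact_sum -scaler_sum2.
rewrite (eq_bigr _ (fun m _ => lactZ c a (c b x m) (inn m A))).
rewrite [X in _ - X](eq_bigr (fun m => c a x m *: lact c b (inn m A)
   - c a x m *: \sum_p c b m p *: inn p A)); last by move=> m _; rewrite inn_lact scalerBr.
by rewrite sumrB opprB addrA addrAC.
Qed.

(** After contraction, the terms with one bracket cancel, and those with two brackets on the
    contracted slot combine by the Jacobi identity. *)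
Lemma lact_comm k a b (A : T k) :
  lact c a (lact c b A) - lact c b (lact c a A) = \sum_m c a b m *: lact c m A.
Proof.
elim: k A => [|k IH] A.
  by rewrite !lact0E subrr big1 // => m _; rewrite lact0E scaler0.
apply: inn_ext => x; rewrite innB !inn_lact_lact inn_sum.
rewrite [RHS](eq_bigr (fun m => c a b m *: lact c m (inn x A)
   - c a b m *: \sum_p c m x p *: inn p A)); last first.
  by move=> m _; rewrite innZ inn_lact scalerBr.
rewrite sumrB -IH scaler_sum2.
rewrite [X in _ = _ - X](eq_bigr (fun p => (\sum_m c b x m * c a m p) *: inn p A
   - (\sum_m c a x m * c b m p) *: inn p A)); last first.
  by move=> p _; rewrite -(c_jacobi hlie) scalerBl.
by rewrite sumrB; tensor_ring.
Qed.

Lemma lact_dif k a (A : T k) : lact c a (dif c A) = dif c (lact c a A).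
Proof.
elim: k A => [|k IH] A; first by rewrite !dif0 lact0.
apply: inn_ext => x; rewrite inn_lact inn_dif [in RHS]inn_dif inn_lact.
rewrite lactB lactN IH difB dif_sum.
rewrite (eq_bigr (fun m => - (c a x m *: lact c m A) - c a x m *: dif c (inn m A))).
  rewrite sumrB sumrN -lact_comm (eq_bigr _ (fun m _ => difZ c (c a x m) (inn m A))).
  by tensor_ring.
by move=> m _; rewrite inn_dif scalerBr scalerN.
Qed.

(** Using Cartan's formula twice, i_b d d = - L_b d + d L_b + d d i_b; the first two terms cancel
    and the last vanishes by induction. *)
Lemma dif_dif k (A : T k) : dif c (dif c A) = 0.
Proof.
elim: k A => [|k IH] A; first by rewrite dif0 difr0.
apply: inn_ext => b; rewrite inn_dif inn_dif difB difN IH lact_dif inn0.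
by tensor_ring.
Qed.

Lemma sum_lact_skew k a b (A : T k.+1) :
  \sum_m c a b m *: inn m A = - \sum_m c b a m *: inn m A.
Proof. by rewrite -sumrN; apply: eq_bigr => m _; rewrite (c_skew hlie) scaleNr. Qed.

Lemma alt_lact k a (A : T k) : alt A -> alt (lact c a A).
Proof.
elim: k A => [|k IH] A hA; first exact: alt_deg0.
case: k IH A hA => [|k] IH A hA; first exact: alt_deg1.
apply: alt_intro => [x|x y]; rewrite !inn_lact.
  apply: altB; first by apply: IH; apply: alt_inn.
  by apply: alt_sum => m; apply: altZ; apply: alt_inn.
rewrite !innB !inn_sum !inn_lact.
rewrite (alt_innC x y hA) lactN.
rewrite (eq_bigr (fun m => - (c a x m *: inn y (inn m A)))); last first.
  by move=> m _; rewrite (alt_innC _ _ hA) scalerN.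
rewrite [\sum_i inn x _](eq_bigr (fun m => - (c a y m *: inn m (inn x A)))); last first.
  by move=> m _; rewrite innZ (alt_innC _ _ hA) scalerN.
rewrite [\sum_i inn y _](eq_bigr (fun m => c a x m *: inn y (inn m A))); last first.
  by move=> m _; rewrite innZ.
rewrite !sumrN; tensor_ring.
Qed.

Lemma alt_dif k (A : T k) : alt A -> alt (dif c A).
Proof.
elim: k A => [|k IH] A hA; first exact: alt_deg1.
apply: alt_intro => [x|x y]; rewrite !inn_dif.
  by apply: altB; [apply/altN/alt_lact | apply/IH/alt_inn].
rewrite !innB !innN !inn_lact (sum_lact_skew x y).
case: k IH A hA => [|k] IH A hA; first by rewrite !lact0E !dif0 !inn0; tensor_ring.
by rewrite !inn_dif (alt_innC x y hA) difN; tensor_ring.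
Qed.

(* The coframe dual to the basis [e_a]. *)
Definition dlt (a : 'I_n) : 'I_n -> R := fun x => (x == a)%:R.

Lemma sum_dlt (V : lmodType R) b (F : 'I_n -> V) : \sum_a dlt a b *: F a = F b.
Proof.
rewrite (bigD1 b) //= /dlt eqxx scale1r big1 ?addr0 // => a.
by rewrite eq_sym => /negPf->; rewrite scale0r.
Qed.

Lemma wdg_dlt k f (A : T k) : wdg f A = \sum_a f a *: wdg (dlt a) A.
Proof.
rewrite -wdg_suml; apply: wdg_eql => x; rewrite -[LHS](sum_delta x).
by apply: eq_bigr => a _; rewrite mulrC /dlt eq_sym.
Qed.

(** The derivation L_b is the sum of (L_b e^m) /\ i_m; the covector in the formula is L_b e^m after
    using skewness of the bracket. *)
Lemma lact_altE k b (A : T k.+1) : alt A ->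
  lact c b A = \sum_m wdg (fun x => c x b m) (inn m A).
Proof.
elim: k A => [|k IH] A hA; apply: inn_ext => x; rewrite inn_lact inn_sum sum_lact_skew opprK.
  by rewrite lact0E add0r; apply: eq_bigr => m _; rewrite inn_wdg0.
rewrite IH; last exact: alt_inn.
rewrite addrC -big_split; apply: eq_bigr => m _.
by rewrite inn_wdg (alt_innC x m hA) wdgN opprK.
Qed.

Lemma wdg_inn_degree k (A : T k.+1) : alt A ->
  \sum_a wdg (dlt a) (inn a A) = k.+1%:R *: A.
Proof.
elim: k A => [|k IH] A hA; apply: inn_ext => x; rewrite inn_sum innZ.
  by rewrite scale1r; under eq_bigr do rewrite inn_wdg0; exact: sum_dlt.
rewrite (eq_bigr (fun a => dlt a x *: inn a A + wdg (dlt a) (inn a (inn x A)))).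
  rewrite big_split sum_dlt /= IH; last exact: alt_inn.
  by rewrite [in RHS]mulrS scalerDl scale1r.
by move=> a _; rewrite inn_wdg (alt_innC x a hA) wdgN opprK.
Qed.

(** Origin of the factor 2: contracting the sum with e_b produces L_b A twice, once from the coframe
    and once from the commutator of L_a with i_b, which [lact_altE] recognizes. *)
Lemma wdg_lact_dif k (A : T k) : alt A ->
  \sum_a wdg (dlt a) (lact c a A) = - 2 *: dif c A.
Proof.
elim: k A => [|k IH] A hA.
  by rewrite dif0 scaler0 big1 // => a _; rewrite lact0E wdg0.
apply: inn_ext => b; rewrite inn_sum innZ inn_dif.
rewrite (eq_bigr (fun a => dlt a b *: lact c a A - wdg (dlt a) (lact c a (inn b A))
   + \sum_m c a b m *: wdg (dlt a) (inn m A))); last first.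
  move=> a _; rewrite inn_wdg inn_lact wdgB wdg_sum opprB addrA addrAC; congr (_ + _).
  by apply: eq_bigr => m _; rewrite wdgZ.
rewrite big_split sumrB sum_dlt IH; last exact: alt_inn.
rewrite /= exchange_big /=.
rewrite (eq_bigr (fun m => wdg (fun x => c x b m) (inn m A))).
  by rewrite -lact_altE //; tensor_ring.
by move=> m _; rewrite [RHS]wdg_dlt.
Qed.

Definition ip k (A B : T k) : R := locked_with form_key (@ipk R n c k) A B.

Lemma ip_ipk k (A B : T k) : ip A B = ipk c A B.
Proof. by rewrite /ip; case: form_key. Qed.

(** Splits off the first slot of both tuples, so that the inner product too can be treated by
    induction on the degree. *)
Lemma ip_rec k (A B : T k.+1) :
  ip A B = k.+1%:R^-1 * \sum_a \sum_b gi a b * ip (inn a A) (inn b B).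
Proof.
rewrite ip_ipk /ipk factS natrM invfM -mulrA; congr (_ * _).
rewrite sum_tcons mulr_sumr; apply: eq_bigr => a _.
under eq_bigr do rewrite sum_tcons.
rewrite exchange_big mulr_sumr; apply: eq_bigr => b _ /=.
rewrite ip_ipk /ipk mulrCA; congr (_ * _); rewrite mulr_sumr; apply: eq_bigr => s _.
rewrite mulr_sumr; apply: eq_bigr => t _.
rewrite big_ord_recl !tcons0 !innE.
under eq_bigr do rewrite !tconsS.
by ring.
Qed.

Lemma ip0E (A B : T 0) t : ip A B = A t * B t.
Proof.
rewrite ip_ipk /ipk fact0 invr1 mul1r.
rewrite (bigD1 t) //= (bigD1 t) //= big_ord0 mulr1 !big1 ?addr0 // => s; rewrite (tup0_eq s t) eqxx //.
Qed.

Lemma ip_lin k a (x y z : T k) : ip (a *: x + y) z = a * ip x z + ip y z.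
Proof.
rewrite !ip_ipk /ipk mulrCA -mulrDr; congr (_ * _); rewrite mulr_sumr -big_split.
apply: eq_bigr => s _ /=; rewrite mulr_sumr -big_split; apply: eq_bigr => t _ /=.
by rewrite tens_addE tens_scaleE; ring.
Qed.

Lemma ipC k (A B : T k) : ip A B = ip B A.
Proof.
rewrite !ip_ipk /ipk; congr (_ * _); rewrite exchange_big; apply: eq_bigr => s _.
apply: eq_bigr => t _ /=; rewrite [A _ * _]mulrC; congr (_ * _).
by apply: eq_bigr => i _; rewrite gi_sym.
Qed.

Lemma ip_gt0 k (A : T k) : A != 0 -> 0 < ip A A.
Proof.
elim: k A => [|k IH] A nz.
  have [t At] : exists t, A t != 0.
    apply/existsP; apply: contraNT nz; rewrite negb_exists => /forallP h.
    by apply/eqP/ffunP => t; rewrite tens_zeroE; apply/eqP; move: (h t); rewrite negbK.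
  by rewrite (ip0E A A t) -expr2 exprn_even_gt0.
rewrite ip_rec mulr_gt0 // ?invr_gt0 ?ltr0n //.
apply: (@posdef_sum R n (invmx (gmx c)) _ (@ip k) (@ipC k) (@ip_lin k) IH
  (gmxV_sym c) (gmxV_posdef hcompact) (fun a => inn a A)).
have [a ha] : exists a, inn a A != 0; last by exists a.
apply/existsP; apply: contraNT nz; rewrite negb_exists => /forallP h.
apply/eqP/inn_ext => a; rewrite inn0; apply/eqP; move: (h a); exact: negbNE.
Qed.

Lemma ip0l k (x : T k) : ip 0 x = 0.
Proof. exact: (form_0l (@ip_lin k)). Qed.
Lemma ipDl k (x y z : T k) : ip (x + y) z = ip x z + ip y z.
Proof. exact: (form_Dl (@ip_lin k)). Qed.
Lemma ipZl k a (x z : T k) : ip (a *: x) z = a * ip x z.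
Proof. exact: (form_Zl (@ip_lin k)). Qed.
Lemma ipBl k (x y z : T k) : ip (x - y) z = ip x z - ip y z.
Proof. exact: (form_Bl (@ip_lin k)). Qed.
Lemma ip0r k (x : T k) : ip x 0 = 0.
Proof. by rewrite ipC ip0l. Qed.
Lemma ipDr k (x y z : T k) : ip x (y + z) = ip x y + ip x z.
Proof. exact: (form_Dr (@ipC k) (@ip_lin k)). Qed.
Lemma ipZr k a (x z : T k) : ip x (a *: z) = a * ip x z.
Proof. exact: (form_Zr (@ipC k) (@ip_lin k)). Qed.
Lemma ipBr k (x y z : T k) : ip x (y - z) = ip x y - ip x z.
Proof. by rewrite ipC ipBl !(ipC x). Qed.
Lemma ip_suml (I : finType) k (F : I -> T k) x : ip (\sum_i F i) x = \sum_i ip (F i) x.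
Proof. by elim/big_rec2: _ => [|i u v _ <-]; rewrite ?ip0l ?ipDl. Qed.
Lemma ip_sumr (I : finType) k (F : I -> T k) x : ip x (\sum_i F i) = \sum_i ip x (F i).
Proof. by rewrite ipC ip_suml; apply: eq_bigr => i _; rewrite ipC. Qed.
Lemma ip_eq0 k (A : T k) : ip A A = 0 -> A = 0.
Proof. exact: (form_eq0 (@ip_gt0 k)). Qed.

Lemma ip_lact k x (A B : T k) : ip (lact c x A) B = - ip A (lact c x B).
Proof.
elim: k A B => [|k IH] A B; first by rewrite !lact0E ip0l ip0r oppr0.
rewrite !ip_rec -mulrN; congr (_ * _).
have := gi_contract hlie hcompact x (fun a b => ip (inn a A) (inn b B) : R^o).
move=> e; apply/eqP; rewrite -subr_eq0 opprK -big_split; apply/eqP => /=.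
rewrite -[RHS](subrr (\sum_a \sum_b gi a b * \sum_m c x a m * ip (inn m A) (inn b B))).
rewrite [X in _ = X - _]e -opprD -big_split -sumrN /=; apply: eq_bigr => a _.
rewrite -!big_split -sumrN /=; apply: eq_bigr => b _.
rewrite !inn_lact ipBl ipBr IH ip_suml ip_sumr.
under [in LHS]eq_bigr do rewrite ipZl.
rewrite -!mulrDr -mulrN; congr (_ * _).
under [X in - ip _ _ - _ + (_ - X)]eq_bigr do rewrite ipZr.
rewrite /GRing.scale /=; ring.
Qed.

(** Contraction with the vector that the metric associates with the covector [f]. *)
Definition innv k (f : 'I_n -> R) (A : T k.+1) : T k :=
  \sum_a \sum_b (f a * gi a b) *: inn b A.

Lemma inn_innv k f x (A : T k.+2) : alt A -> inn x (innv f A) = - innv f (inn x A).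
Proof.
move=> hA; rewrite inn_sum -sumrN; apply: eq_bigr => a _; rewrite inn_sum -sumrN.
by apply: eq_bigr => b _; rewrite innZ (alt_innC x b hA) scalerN.
Qed.

Lemma ip_wdg k f (A : T k) (B : T k.+1) : alt B -> ip (wdg f A) B = ip A (innv f B).
Proof.
have e j (A' : T j) (B' : T j.+1) :
    \sum_a \sum_b gi a b * ip (f a *: A') (inn b B') = ip A' (innv f B').
  rewrite ip_sumr; apply: eq_bigr => a _; rewrite ip_sumr; apply: eq_bigr => b _.
  by rewrite ipZl ipZr; ring.
elim: k A B e => [|k IH] A B e hB; rewrite ip_rec.
  rewrite invr1 mul1r -e; apply: eq_bigr => a _; apply: eq_bigr => b _.
  by rewrite inn_wdg0.
rewrite (eq_bigr (fun a => \sum_b gi a b * ip (f a *: A) (inn b B)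
  + \sum_b gi a b * ip (inn a A) (inn b (innv f B)))); last first.
  move=> a _; rewrite -big_split; apply: eq_bigr => b _ /=.
  rewrite inn_wdg ipBl IH //; last exact: alt_inn.
  by rewrite inn_innv // -scaleN1r ipZr; ring.
(* The first part equals [ip A (innv f B)] and the second is k + 1 times it, matching the weight
   1/(k + 2) of [ip_rec]. *)
rewrite big_split /= e.
have := ip_rec A (innv f B) => /(congr1 (fun z => k.+1%:R * z)).
rewrite mulrA divff ?pnatr_eq0 // mul1r => <-.
have : k.+2%:R != 0 :> R by rewrite pnatr_eq0.
rewrite [k.+2%:R]mulrS; move: k.+1%:R => r nz; field.
by move: nz; rewrite addrC.
Qed.

Definition del k (A : T k.+1) : T k :=
  2^-1 *: \sum_a \sum_b gi a b *: lact c a (inn b A).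

Lemma alt_del k (A : T k.+1) : alt A -> alt (del A).
Proof.
move=> hA; apply: altZ; apply: alt_sum => a; apply: alt_sum => b; apply: altZ.
by apply: alt_lact; apply: alt_inn.
Qed.

Fact del_linear k : linear (@del k).
Proof.
move=> x A B; rewrite /del scalerA mulrC -scalerA -scalerDr; congr (_ *: _).
rewrite scaler_sumr -big_split; apply: eq_bigr => a _.
rewrite scaler_sumr -big_split; apply: eq_bigr => b _ /=.
by rewrite innD innZ lactD lactZ scalerDr !scalerA mulrC.
Qed.
HB.instance Definition _ k := GRing.isLinear.Build R _ _ _ (@del k) (@del_linear k).
Lemma delZ k a (A : T k.+1) : del (a *: A) = a *: del A. Proof. exact: linearZ. Qed.
Lemma delB k (A B : T k.+1) : del (A - B) = del A - del B. Proof. exact: linearB. Qed.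
Lemma delD k (A B : T k.+1) : del (A + B) = del A + del B. Proof. exact: linearD. Qed.
Lemma delr0 k : del (0 : T k.+1) = 0. Proof. exact: linear0. Qed.

(** Adjoint of [wdg_lact_dif]: exterior multiplication is adjoint to contraction and L_a is skew,
    which turns the sum of e^a /\ L_a into the formula defining [del]. *)
Lemma ip_dif k (A : T k) (B : T k.+1) : alt A -> alt B -> ip (dif c A) B = ip A (del B).
Proof.
move=> hA hB; have -> : dif c A = - 2^-1 *: \sum_a wdg (dlt a) (lact c a A).
  by rewrite wdg_lact_dif // scalerA mulrNN mulVf ?scale1r // pnatr_eq0.
rewrite ipZl ip_suml mulNr -mulrN -sumrN /del ipZr; congr (_ * _).
rewrite ip_sumr; apply: eq_bigr => a _; rewrite ip_wdg // ip_lact opprK.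
congr (ip _ _); rewrite /innv exchange_big lact_sum; apply: eq_bigr => b _ /=.
rewrite -lactZ; congr lact; rewrite -scaler_suml; congr (_ *: _).
by rewrite -[RHS](sum_delta a (fun x => gi x b)).
Qed.

Lemma lact_del k x (A : T k.+1) : lact c x (del A) = del (lact c x A).
Proof.
rewrite lactZ; congr (_ *: _); rewrite lact_sum.
have e := gi_contract hlie hcompact x (fun a b => lact c a (inn b A)).
apply/eqP; rewrite -subr_eq0 -sumrB; apply/eqP.
rewrite -[RHS](subrr (\sum_a \sum_b gi a b *: \sum_m c x a m *: lact c m (inn b A))).
rewrite [X in _ = _ - X]e opprK -big_split; apply: eq_bigr => a _ /=.
rewrite lact_sum -sumrB -big_split; apply: eq_bigr => b _ /=.
rewrite lactZ -scalerBr -scalerDr; congr (_ *: _).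
rewrite -[lact c x (lact c a _)](subrK (lact c a (lact c x (inn b A)))) lact_comm lact_inn.
rewrite lactD lact_sum (eq_bigr _ (fun m _ => lactZ c a (c x b m) (inn m A))).
by tensor_ring.
Qed.

Definition cas k (A : T k) : T k := \sum_a \sum_b gi a b *: lact c a (lact c b A).

(** Since d commutes with L_a, the left side is half the contraction of L_a (d i_b + i_b d), and
    Cartan's formula makes this - L_a L_b. *)
Lemma dif_del k (A : T k.+1) : dif c (del A) + del (dif c A) = - 2^-1 *: cas A.
Proof.
rewrite difZ -scalerDr scaleNr -scalerN; congr (_ *: _).
rewrite dif_sum -big_split -sumrN; apply: eq_bigr => a _ /=.
rewrite dif_sum -big_split -sumrN; apply: eq_bigr => b _ /=.
rewrite difZ -scalerDr -scalerN; congr (_ *: _); rewrite inn_dif lactB lactN -lact_dif.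
by tensor_ring.
Qed.

Lemma del_del k (A : T k.+2) : alt A -> del (del A) = 0.
Proof.
move=> hA; have hd := alt_del hA; have hdd := alt_del hd; apply: ip_eq0.
by rewrite -ip_dif // -ip_dif ?dif_dif ?ip0l //; apply: alt_dif.
Qed.

(** The Casimir operator of the adjoint representation. Invariance ([h1], [h2]) moves the inverse
    metric off the summed pair, so that the two structure constants form the Killing form, which is
    minus the metric: hence exactly -1. *)
Lemma casimir_adjoint x p :
  \sum_a \sum_b \sum_m gi a b * (c a x m * c b m p) = - (x == p)%:R.
Proof.
have h1 m b : \sum_a gi a b * c a x m = \sum_a gi m a * c x a b.
  have := gi_inv hlie hcompact x m b.
  have -> : \sum_a c x a m * gi a b = - \sum_a gi a b * c a x m.
    by rewrite -sumrN; apply: eq_bigr => a _; rewrite (c_skew hlie) mulNr mulrC.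
  have -> : \sum_a c x a b * gi m a = \sum_a gi m a * c x a b.
    by apply: eq_bigr => a _; rewrite mulrC.
  move=> h; lra.
have h2 a b : \sum_m gi m a * c b m p = - \sum_m gi p m * c b m a.
  have := gi_inv hlie hcompact b p a.
  have -> : \sum_m c b m p * gi m a = \sum_m gi m a * c b m p.
    by apply: eq_bigr => m _; rewrite mulrC.
  have -> : \sum_m c b m a * gi p m = \sum_m gi p m * c b m a.
    by apply: eq_bigr => m _; rewrite mulrC.
  move=> h; lra.
rewrite exchange_big /=.
transitivity (\sum_b \sum_m (\sum_a gi m a * c x a b) * c b m p).
  apply: eq_bigr => b _; rewrite exchange_big; apply: eq_bigr => m _ /=.
  by rewrite -h1 mulr_suml; apply: eq_bigr => a _; rewrite mulrA.
transitivity (\sum_b \sum_a c x a b * \sum_m gi m a * c b m p).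
  apply: eq_bigr => b _; under eq_bigr do rewrite mulr_suml; rewrite exchange_big.
  apply: eq_bigr => a _; rewrite mulr_sumr; apply: eq_bigr => m _ /=; ring.
transitivity (\sum_m gi p m * killing_mx c x m); last first.
  rewrite eq_sym -(gi_gm hcompact p x) -sumrN; apply: eq_bigr => m _.
  by rewrite (gm_sym c m) /metric mulrN opprK.
transitivity (\sum_b \sum_a \sum_m gi p m * (c x a b * c m b a)).
  apply: eq_bigr => b _; apply: eq_bigr => a _; rewrite h2 -sumrN mulr_sumr.
  by apply: eq_bigr => m _; rewrite [c b m a](c_skew hlie); ring.
under eq_bigr do rewrite exchange_big.
rewrite exchange_big; apply: eq_bigr => m _ /=; rewrite mulr_sumr.
by apply: eq_bigr => b _; rewrite mulr_sumr.
Qed.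

Lemma cas_deg1 (A : T 1) : cas A = - A.
Proof.
apply: inn_ext => x; rewrite innN inn_sum.
rewrite (eq_bigr (fun a => \sum_b \sum_p (\sum_m gi a b * (c a x m * c b m p)) *: inn p A)).
  under eq_bigr do rewrite exchange_big.
  rewrite exchange_big /= -[RHS]scaleN1r -[inn x A](sum_dlt x (fun p => inn p A)) scaler_sumr.
  apply: eq_bigr => p _.
  under eq_bigr do rewrite -scaler_suml.
  by rewrite -scaler_suml casimir_adjoint scalerA mulN1r /dlt.
move=> a _; rewrite inn_sum; apply: eq_bigr => b _; rewrite innZ inn_lact_lact.
rewrite lact0E [X in _ - X - _]big1 => [|m _]; last by rewrite lact0E scaler0.
rewrite subr0 [X in _ - X + _]big1 => [|m _]; last by rewrite lact0E scaler0.
rewrite subr0 add0r scaler_sumr; apply: eq_bigr => p _.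
by rewrite scalerA mulr_sumr.
Qed.

Lemma invariant_deg1 (A : T 1) : (forall a, lact c a A = 0) -> A = 0.
Proof.
move=> h; apply/eqP; rewrite -oppr_eq0 -cas_deg1 /cas.
by rewrite big1 // => a _; rewrite big1 // => b _; rewrite h lact0 scaler0.
Qed.

(* [[a, b] _| x _| A] is antisymmetric in (a, b) and, by invariance, symmetric
   in (b, x). *)
Lemma invariant_deg2 (A : T 2) : alt A -> (forall a, lact c a A = 0) -> A = 0.
Proof.
move=> hA h; pose G a b x := \sum_m c a b m *: inn x (inn m A).
have G1 a b x : G a b x = - G b a x.
  by rewrite -sumrN; apply: eq_bigr => m _; rewrite (c_skew hlie) scaleNr.
have Gi a b : lact c a (inn b A) = \sum_m c a b m *: inn m A.
  by rewrite lact_inn h inn0 add0r.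
have G2 a b x : G a b x = G a x b.
  have := congr1 (inn x) (Gi a b); rewrite inn_lact lact0E add0r inn_sum.
  rewrite [RHS](eq_bigr _ (fun m _ => innZ x (c a b m) (inn m A))) -/(G a b x) => <-.
  by rewrite -sumrN; apply: eq_bigr => m _; rewrite (alt_innC m b hA) scalerN opprK.
(* Alternating the two symmetries three times each returns to (a, b, x) with an odd number of sign
   changes. *)
have G0 a b x : G a b x = 0.
  have : G a b x = - G a b x.
    by rewrite {1}(G2 a b x) (G1 a x b) (G2 x a b) (G1 x b a) (G2 b x a) (G1 b a x) opprK.
  move/eqP; rewrite -subr_eq0 opprK -mulr2n -scaler_nat scaler_eq0 pnatr_eq0 /=.
  by move=> /eqP.
(* [G0] says that each one-form i_b A is invariant, hence zero. *)
apply: inn_ext => b; rewrite inn0; apply: invariant_deg1 => a; apply: inn_ext => x.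
by rewrite Gi inn_sum inn0 -[RHS](G0 a b x); apply: eq_bigr => m _; rewrite innZ.
Qed.

Lemma ip_cas k (A : T k) : ip A (cas A) = - \sum_a \sum_b gi a b * ip (lact c a A) (lact c b A).
Proof.
rewrite ip_sumr -sumrN; apply: eq_bigr => a _; rewrite ip_sumr -sumrN.
by apply: eq_bigr => b _; rewrite ipZr ip_lact mulrN opprK.
Qed.

(** The pairing is minus a positive definite expression in the family of all L_a A. *)
Lemma ip_cas_eq0 k (A : T k) : ip A (cas A) = 0 -> forall a, lact c a A = 0.
Proof.
rewrite ip_cas => /eqP; rewrite oppr_eq0 => /eqP h a; apply/eqP; apply: contraT => nz.
have := @posdef_sum R n (invmx (gmx c)) _ (@ip k) (@ipC k) (@ip_lin k) (@ip_gt0 k)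
  (gmxV_sym c) (gmxV_posdef hcompact) (fun a => lact c a A) (ex_intro _ a nz).
by rewrite h ltxx.
Qed.

Lemma cas_del_free k (A : T k.+1) : del A = 0 -> cas A = - 2 *: del (dif c A).
Proof.
move=> dA; have := dif_del A; rewrite dA difr0 add0r => ->.
by rewrite scalerA mulrNN mulfV ?scale1r // pnatr_eq0.
Qed.

(** One-forms are coclosed and Cas is -1 on them; this 1/2 is the source of the 2 in
    [coclosed_proj]. *)
Lemma del_dif_deg1 (A : T 1) : del (dif c A) = 2^-1 *: A.
Proof.
have d0 : del A = 0.
  by rewrite /del !big1 ?scaler0 // => a _; rewrite big1 // => b _; rewrite lact0E scaler0.
by have := dif_del A; rewrite d0 difr0 add0r cas_deg1 scalerN scaleNr opprK.
Qed.

(* Projection onto the kernel of [del] along the image of [dif]. *)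
Definition coclosed_proj (A : T 2) : T 2 := A - 2 *: dif c (del A).

Lemma coclosed_proj_alt A : alt A -> alt (coclosed_proj A).
Proof. by move=> hA; apply: altB => //; apply/altZ/alt_dif/alt_del. Qed.

Lemma del_coclosed_proj A : del (coclosed_proj A) = 0.
Proof.
rewrite /coclosed_proj delB delZ del_dif_deg1 scalerA mulfV ?pnatr_eq0 //.
by rewrite scale1r subrr.
Qed.

Lemma dif_coclosed_proj A : dif c (coclosed_proj A) = dif c A.
Proof. by rewrite difB difZ dif_dif scaler0 subr0. Qed.

End Calculus.

(** * Permutation sums expanded one slot at a time *)

Section Shuffles.
Variables (R : rcfType) (n : nat).
Local Notation T k := (Tens R n k).

(** A permutation is the image [j] of [i] together with a permutation of the rest; injectivity and
    equality of cardinals suffice. *)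
Lemma sum_lift_perm k (i : 'I_k.+1) (F : 'S_k.+1 -> R) :
  \sum_s F s = \sum_j \sum_(s : 'S_k) F (lift_perm i j s).
Proof.
rewrite pair_bigA /= (reindex (fun p : 'I_k.+1 * 'S_k => lift_perm i p.1 p.2)) //.
apply: onW_bij; apply: inj_card_bij; last first.
  by rewrite card_prod card_ord !card_Sn factS.
move=> [j1 s1] [j2 s2] /= e.
have ej : j1 = j2 by rewrite -(lift_perm_id i j1 s1) e lift_perm_id.
rewrite -ej in e *; congr (_, _); apply/permP => l.
by apply: (@lift_inj _ j1); rewrite -!(lift_perm_lift i) e.
Qed.

(** Laplace expansion along the first slot. *)
Lemma perm_split k (t : tup n k.+1) (G : 'I_n -> tup n k -> R) :
  \sum_(s : 'S_k.+1) (-1) ^+ s * G (t (s ord0)) [ffun i => t (s (lift ord0 i))] =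
  \sum_(j < k.+1) (-1) ^+ j * \sum_(s : 'S_k) (-1) ^+ s * G (t j) [ffun i => t (lift j (s i))].
Proof.
rewrite (sum_lift_perm ord0); apply: eq_bigr => j _; rewrite mulr_sumr.
apply: eq_bigr => s _; rewrite odd_lift_perm signr_addb signr_odd -mulrA lift_perm_id.
congr (_ * (_ * G _ _)); apply/ffunP => i; by rewrite !ffunE lift_perm_lift.
Qed.

Lemma sum_perm_alt k (B : T k) (t : tup n k) : alt B ->
  \sum_(s : 'S_k) (-1) ^+ s * B [ffun i => t (s i)] = k`!%:R * B t.
Proof.
move=> hB; under eq_bigr do rewrite hB mulrA -signr_addb addbb mul1r.
by rewrite sumr_const card_Sn mulr_natl.
Qed.

Lemma lift_lift0 k (j : 'I_k.+1) (i : 'I_k) :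
  lift (lift ord0 j) (lift ord0 i) = lift ord0 (lift j i).
Proof. by apply: val_inj; rewrite /= /bump /=; lia. Qed.

Lemma wdg_eval k f (A : T k) t :
  wdg f A t = \sum_(j < k.+1) (-1) ^+ j * (f (t j) * A [ffun i => t (lift j i)]).
Proof.
elim: k A t => [|k IH] A t; rewrite -[in LHS](tcons_eta t) -innE.
  rewrite inn_wdg0 big_ord1 expr0 mul1r tens_scaleE; congr (_ * _); congr (A _); exact: tup0_eq.
rewrite inn_wdg tens_addE tens_oppE tens_scaleE IH [in RHS]big_ord_recl expr0 mul1r.
congr (_ + _).
rewrite -sumrN; apply: eq_bigr => j _.
rewrite innE exprS mulN1r mulNr ffunE; congr (- _); congr (_ * _); congr (_ * _); congr (A _).
apply/ffunP => i; rewrite [in RHS]ffunE; case: (unliftP ord0 i) => [l ->|->].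
  by rewrite tconsS lift_lift0 !ffunE.
by rewrite tcons0; congr (t _); apply: val_inj.
Qed.

Lemma wdg_family_eval k (F : 'I_n -> T k) t :
  (\sum_a wdg (dlt R a) (F a)) t =
  \sum_(j < k.+1) (-1) ^+ j * F (t j) [ffun i => t (lift j i)].
Proof.
rewrite sum_ffunE; under eq_bigr do rewrite wdg_eval.
rewrite exchange_big; apply: eq_bigr => j _ /=; rewrite -mulr_sumr; congr (_ * _).
under eq_bigr do rewrite /dlt eq_sym.
exact: (sum_delta (t j) (fun a => F a [ffun i => t (lift j i)])).
Qed.

Lemma wedge1E k (A : T 1) (B : T k) : alt B ->
  wedge A B = wdg (fun a => A [ffun=> a]) B :> T k.+1.
Proof.
move=> hB; apply/ffunP => t; rewrite ffunE wdg_eval.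
rewrite (eq_bigr (fun s : 'S_k.+1 => (-1) ^+ s *
   (fun a u => A [ffun=> a] * B u) (t (s ord0)) [ffun i => t (s (lift ord0 i))])).
  rewrite (perm_split t (fun a u => A [ffun=> a] * B u)) mulr_sumr.
  apply: eq_bigr => j _; rewrite mulrCA; congr (_ * _).
  transitivity ((1`! * k`!)%:R^-1 * (A [ffun=> t j] * (k`!%:R * B [ffun i => t (lift j i)]))).
    congr (_ * _); rewrite -sum_perm_alt // mulr_sumr; apply: eq_bigr => s _.
    rewrite mulrCA; congr (_ * (_ * B _)); apply/ffunP => i; by rewrite !ffunE.
  rewrite mul1n mulrCA [X in _ * X]mulrA mulVf ?mul1r //.
  by rewrite pnatr_eq0 -lt0n fact_gt0.
move=> s _; rewrite -mulrA; congr (_ * (A _ * B _)); apply/ffunP => i; rewrite !ffunE.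
  by congr (t (s _)); apply: val_inj; rewrite (ord1 i).
by congr (t (s _)); apply: val_inj.
Qed.

(** Expansion along the last slot, where [B] sits; the sign is that of moving a one-form past three
    others. *)
Lemma wedge31E (A : T 3) (B : T 1) : alt A ->
  wedge A B = - wdg (fun a => B [ffun=> a]) A :> T 4.
Proof.
move=> hA; apply/ffunP => t; rewrite tens_oppE ffunE wdg_eval -sumrN.
rewrite (@sum_lift_perm 3 ord_max) mulr_sumr; apply: eq_bigr => j _.
transitivity ((3`! * 1`!)%:R^-1 * (- (-1) ^+ j * (B [ffun=> t j] *
   (3`!%:R * A [ffun i => t (lift j i)])))); last first.
  rewrite muln1; have : 3`!%:R != 0 :> R by rewrite pnatr_eq0.
  move: 3`!%:R ((-1) ^+ j) (B _) (A _) => r x u v nz; field; exact: nz.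
congr (_ * _); rewrite -sum_perm_alt // !mulr_sumr; apply: eq_bigr => s _.
rewrite odd_lift_perm 2!signr_addb 2!signr_odd.
have -> : (-1) ^+ (ord_max : 'I_4) = -1 :> R by rewrite -signr_odd.
have -> : [ffun i : 'I_3 => t (lift_perm ord_max j s (lshift 1 i))] =
    [ffun i => [ffun i0 => t (lift j i0)] (s i)] :> tup n 3.
  apply/ffunP => i; rewrite !ffunE -(lift_perm_lift ord_max j); congr (t (_ _)).
  by apply: val_inj; rewrite /= /bump; have := ltn_ord i; lia.
have -> : [ffun i : 'I_1 => t (lift_perm ord_max j s (rshift 3 i))] = [ffun=> t j] :> tup n 1.
  apply/ffunP => i; rewrite !ffunE -[X in _ = t X](lift_perm_id ord_max j s).
  by congr (t (_ _)); apply: val_inj; rewrite (ord1 i).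
by rewrite !mulN1r !mulNr -!mulrA; congr (- (_ * _)); rewrite [RHS]mulrCA; congr (_ * _); rewrite mulrC.
Qed.

End Shuffles.

(** * Comparison of the given definitions with the recursive operators *)

Section Bridges.
Variables (R : rcfType) (n : nat) (c : 'I_n -> 'I_n -> 'I_n -> R).
Hypotheses (hlie : is_lie_algebra c) (hcompact : is_compact c).
Local Notation gm := (metric c).
Local Notation gi := (metric_inv c).
Local Notation T k := (Tens R n k).

(** Both sides are multiplied by -2, so that the recursive differential becomes the sum of e^a /\
    L_a A. Expanding the permutation sum along its first slot gives e^a, and along its second slot
    gives L_a A in the form of [lact_altE]. *)
Lemma dgE k (A : T k.+1) : alt A -> dg c A = dif c A.
Proof.
move=> hA; have e2 : 2 != 0 :> R by rewrite pnatr_eq0.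
apply: (scalerI (a := -2)); first by rewrite oppr_eq0.
rewrite -(wdg_lact_dif hlie hA); apply/ffunP => t; rewrite tens_scaleE wdg_family_eval ffunE.
pose G a (u : tup n k.+1) := \sum_m c a (u ord0) m * A (tcons m (tbehead u)).
rewrite (eq_bigr (fun s : 'S_k.+2 => (-1) ^+ s *
   G (t (s ord0)) [ffun i => t (s (lift ord0 i))])) => [|s _]; last first.
  congr (_ * _); apply: eq_bigr => m _; rewrite ffunE; congr (_ * _); congr (A (tcons _ _)).
  by apply/ffunP => i; rewrite !ffunE.
rewrite (perm_split t G) {}/G !mulr_sumr; apply: eq_bigr => j _.
pose u : tup n k.+1 := [ffun i => t (lift j i)].
transitivity (-2 * ((2 * k`!)%:R^-1 * ((-1) ^+ j * (k`!%:R * - lact c (t j) A u)))).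
  congr (_ * (_ * (_ * _))).
  rewrite (lact_altE hlie) // sum_ffunE mulrN mulr_sumr -sumrN.
  transitivity (\sum_m \sum_(s : 'S_k.+1) (-1) ^+ s *
      (c (t j) (u (s ord0)) m * inn m A [ffun i => u (s (lift ord0 i))])).
    rewrite exchange_big; apply: eq_bigr => s _; rewrite mulr_sumr.
    apply: eq_bigr => m _ /=; rewrite innE !ffunE; congr (_ * (_ * A _)).
    by congr tcons; apply/ffunP => i; rewrite !ffunE.
  apply: eq_bigr => m _.
  rewrite (perm_split u (fun a v => c (t j) a m * inn m A v)) wdg_eval mulr_sumr -sumrN.
  apply: eq_bigr => l _; rewrite [c (u l) _ _](c_skew hlie).
  transitivity ((-1) ^+ l * (c (t j) (u l) m * (k`!%:R * inn m A [ffun i => u (lift l i)]))).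
    congr (_ * _); rewrite -sum_perm_alt; last exact: alt_inn.
    rewrite mulr_sumr; apply: eq_bigr => s _; rewrite mulrCA; congr (_ * (_ * inn _ _ _)).
    by apply/ffunP => i; rewrite !ffunE.
  by ring.
rewrite -/u natrM; have : k`!%:R != 0 :> R by rewrite pnatr_eq0 -lt0n fact_gt0.
by move: k`!%:R (lact _ _ _ _) ((-1) ^+ j) => x y z nx; field; rewrite ?nx ?e2.
Qed.

Definition om x y z : R := \sum_k c y z k * killing_mx c x k.

Lemma om_skew23 x y z : om x y z = - om x z y.
Proof. by rewrite -sumrN; apply: eq_bigr => k _; rewrite (c_skew hlie) mulNr. Qed.

Lemma om_skew13 x y z : om x y z = - om z y x.
Proof.
have := killing_inv hlie y x z; rewrite addrC => /eqP; rewrite addr_eq0 => /eqP e.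
rewrite /om e; congr (- _); apply: eq_bigr => m _; congr (_ * _).
by rewrite !killingE mxtrace_mulC.
Qed.

Lemma omegaE x y z (u : tup n 0) : omega c (tcons x (tcons y (tcons z u))) = om x y z.
Proof.
have -> : omega c (tcons x (tcons y (tcons z u))) =
  \sum_k c ((tcons x (tcons y (tcons z u))) (inord 1))
   ((tcons x (tcons y (tcons z u))) (inord 2)) k *
   killing_mx c ((tcons x (tcons y (tcons z u))) (inord 0)) k by rewrite ffunE.
have -> : inord 0 = ord0 :> 'I_3 by apply: val_inj; rewrite /= inordK.
have -> : inord 1 = lift ord0 ord0 :> 'I_3 by apply: val_inj; rewrite /= inordK.
have -> : inord 2 = lift ord0 (lift ord0 ord0) :> 'I_3 by apply: val_inj; rewrite /= inordK.
by rewrite !tconsS !tcons0.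
Qed.

Lemma inn_omega x y z (u : tup n 0) : inn z (inn y (inn x (omega c))) u = om x y z.
Proof. by rewrite !innE omegaE. Qed.

Lemma alt_omega : alt (omega c).
Proof.
have e12 x y z : om x y z = - om y x z.
  by rewrite om_skew23 om_skew13 om_skew23 opprK.
apply: alt_intro => [x|x y]; last first.
  apply: inn_ext => z; apply/ffunP => u.
  by rewrite innN tens_oppE !inn_omega e12.
apply: alt_intro => [y|y z]; first exact: alt_deg1.
by apply/ffunP => u; rewrite tens_oppE !inn_omega om_skew23.
Qed.

Lemma tup2E (tau : T 2) a l (u : tup n 0) : tau (tup2 a l) = inn l (inn a tau) u.
Proof. by rewrite !innE; congr (tau (tcons _ (tcons _ _))); apply: tup0_eq. Qed.

(** [so_of] raises an index with the inverse metric and [om] lowers it with the Killing form, which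
    is minus the metric; only the sign survives. *)
Lemma so_of_om (tau : T 2) x y z (u : tup n 0) :
  \sum_m so_of c tau m x * om m y z = - \sum_k c y z k * inn k (inn x tau) u.
Proof.
transitivity (\sum_k c y z k * \sum_l (\sum_m killing_mx c m k * gi m l) * tau (tup2 x l)).
  under eq_bigr do rewrite mulr_sumr; rewrite exchange_big; apply: eq_bigr => k _ /=.
  rewrite mulr_sumr; under eq_bigr do rewrite mulr_suml.
  rewrite exchange_big; apply: eq_bigr => l _ /=; rewrite mulr_suml mulr_sumr.
  by apply: eq_bigr => m _; ring.
rewrite -sumrN; apply: eq_bigr => k _; rewrite -mulrN; congr (_ * _).
rewrite -(tup2E _ _ _ u) -[in RHS](sum_delta k (fun l => tau (tup2 x l))) -sumrN.
apply: eq_bigr => l _; rewrite -mulNr; congr (_ * _).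
rewrite eq_sym -(gm_gi hcompact k l) -sumrN; apply: eq_bigr => m _.
by rewrite (gm_sym c k) /metric mulNr opprK.
Qed.

(** On basis vectors x, y, z both sides are tau(x,[y,z]) + tau(y,[z,x]) + tau(z,[x,y]). *)
Lemma rho_omega (tau : T 2) : alt tau -> rho (so_of c tau) (omega c) = - dif c tau.
Proof.
move=> ht; apply: inn_ext => x; apply: inn_ext => y; apply: inn_ext => z; apply/ffunP => u.
rewrite !innE ffunE !big_ord_recl big_ord0 addr0 !tconsS !tcons0.
rewrite (eq_bigr (fun m => so_of c tau m x * om m y z)) => [|m _]; last first.
  by rewrite tupd_tcons0 omegaE.
rewrite [X in _ + (X + _)](eq_bigr (fun m => so_of c tau m y * om m z x)) => [|m _]; last first.
  by rewrite tupd_tconsS tupd_tcons0 omegaE om_skew23 om_skew13 opprK.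
rewrite [X in _ + (_ + X)](eq_bigr (fun m => so_of c tau m z * om m x y)) => [|m _]; last first.
  by rewrite !tupd_tconsS tupd_tcons0 omegaE om_skew13 om_skew23 opprK.
rewrite !(so_of_om _ _ _ _ u) !opprD !opprK -!innE.
have -> : inn x (- dif c tau) = lact c x tau + dif c (inn x tau).
  by rewrite innN inn_dif; tensor_ring.
have e1 : inn z (inn y (lact c x tau)) =
    - \sum_m c x z m *: inn m (inn y tau) - \sum_m c x y m *: inn z (inn m tau).
  rewrite inn_lact innB inn_lact lact0E inn_sum sub0r; congr (_ - _).
  by apply: eq_bigr => m _; rewrite innZ.
have e2 : inn z (inn y (dif c (inn x tau))) = \sum_m c y z m *: inn m (inn x tau).
  by rewrite inn_dif innB innN inn_lact lact0E dif0 inn0; tensor_ring.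
rewrite !innD e1 e2 !tens_addE !tens_oppE !sum_ffunE.
under [in RHS]eq_bigr do rewrite tens_scaleE.
under [X in _ = _ - X + _]eq_bigr do rewrite tens_scaleE.
under [X in _ = _ + X]eq_bigr do rewrite tens_scaleE.
have -> : \sum_m c x y m * inn z (inn m tau) u = - \sum_m c x y m * inn m (inn z tau) u.
  by rewrite -sumrN; apply: eq_bigr => m _; rewrite (alt_innC z m ht) tens_oppE mulrN.
have -> : \sum_k c z x k * inn k (inn y tau) u = - \sum_k c x z k * inn k (inn y tau) u.
  by rewrite -sumrN; apply: eq_bigr => m _; rewrite (c_skew hlie) mulNr.
by ring.
Qed.

(** The one-form delta tau is metrically dual to the bracket of tau, which identifies g^perp with
    the coclosed two-forms. The proof moves the structure constant through the metric by invariance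
    ([e]). *)
Lemma del_bracket (tau : T 2) r (u : tup n 0) :
  inn r (del c tau) u = \sum_m gm m r * bracket_map c tau m.
Proof.
pose t k l := tau (tup2 k l).
transitivity (2^-1 * \sum_i \sum_k gi i k * - \sum_l c i r l * t k l).
  rewrite innZ tens_scaleE; congr (_ * _); rewrite inn_sum sum_ffunE; apply: eq_bigr => i _.
  rewrite inn_sum sum_ffunE; apply: eq_bigr => k _; rewrite innZ tens_scaleE inn_lact lact0E add0r.
  rewrite tens_oppE sum_ffunE; congr (_ * - _); apply: eq_bigr => l _.
  by rewrite tens_scaleE -tup2E.
have e i l : \sum_j gi j l * \sum_m gm m r * c i j m = - c i r l.
  transitivity (\sum_j gi j l * - \sum_m c i r m * gm j m).
    apply: eq_bigr => j _; congr (_ * _); apply/eqP.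
    rewrite -addr_eq0; apply/eqP; rewrite -[RHS](gm_inv hlie i j r); congr (_ + _).
    by apply: eq_bigr => m _; rewrite mulrC.
  transitivity (- \sum_m (\sum_j gm m j * gi j l) * c i r m).
    under eq_bigr do rewrite mulrN mulr_sumr; rewrite sumrN exchange_big.
    congr (- _); apply: eq_bigr => m _ /=; rewrite mulr_suml; apply: eq_bigr => j _.
    by rewrite (gm_sym c m); ring.
  congr (- _); under eq_bigr do rewrite gm_gi //.
  exact: (sum_delta l).
transitivity (2^-1 * \sum_i \sum_k gi i k * \sum_l (\sum_j gi j l * \sum_m gm m r * c i j m) * t k l).
  congr (_ * _); apply: eq_bigr => i _; apply: eq_bigr => k _; congr (_ * _).
  by rewrite -sumrN; apply: eq_bigr => l _; rewrite e mulNr.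
under [in RHS]eq_bigr do rewrite ffunE mulrCA mulr_sumr.
rewrite -mulr_sumr; congr (_ * _); rewrite [RHS]exchange_big; apply: eq_bigr => i _ /=.
under [in RHS]eq_bigr do rewrite mulr_sumr.
rewrite [RHS]exchange_big /=.
transitivity (\sum_k \sum_j \sum_l \sum_m gm m r * (gi i k * gi j l * tau (tup2 k l) * c i j m)).
  apply: eq_bigr => k _; rewrite mulr_sumr exchange_big; apply: eq_bigr => l _ /=.
  rewrite mulr_suml mulr_sumr; apply: eq_bigr => j _; rewrite /t.
  rewrite mulr_sumr mulr_suml mulr_sumr; apply: eq_bigr => m _; ring.
rewrite exchange_big; apply: eq_bigr => j _ /=.
rewrite [RHS](eq_bigr (fun m => \sum_k \sum_l gm m r * (gi i k * gi j l * tau (tup2 k l) * c i j m))).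
  rewrite [RHS]exchange_big; apply: eq_bigr => k _ /=; exact: exchange_big.
by move=> m _; rewrite mulr_sumr; apply: eq_bigr => k _; rewrite mulr_sumr.
Qed.

Lemma bracket_map_del (tau : T 2) : bracket_map c tau = 0 <-> del c tau = 0.
Proof.
split=> h.
  apply: inn_ext => r; apply/ffunP => u; rewrite inn0 del_bracket h tens_zeroE.
  by rewrite big1 // => m _; rewrite ffunE mulr0.
apply/ffunP => m; rewrite -(sum_delta m (fun j => bracket_map c tau j)) ffunE.
transitivity (\sum_r gi r m * \sum_j gm j r * bracket_map c tau j).
  under [RHS]eq_bigr do rewrite mulr_sumr.
  rewrite exchange_big; apply: eq_bigr => j _ /=.
  rewrite -(gm_gi hcompact j m) mulr_suml; apply: eq_bigr => r _; ring.
rewrite big1 // => r _; rewrite -(del_bracket _ _ [ffun i : 'I_0 => r]) h inn0 tens_zeroE mulr0 //.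
Qed.

Lemma gperp_del (tau : T 2) : gperp c tau <-> alt tau /\ del c tau = 0.
Proof. by split=> -[h1 /bracket_map_del h2]; split. Qed.

End Bridges.

(** * Contractions with the metric and the invariance argument for (5) *)

Section Contractions.
Variables (R : rcfType) (n : nat) (c : 'I_n -> 'I_n -> 'I_n -> R).
Hypotheses (hlie : is_lie_algebra c) (hcompact : is_compact c).
Local Notation gm := (metric c).
Local Notation gi := (metric_inv c).
Local Notation T k := (Tens R n k).
Local Notation dlt := (dlt R).

Lemma sum_gi_gm (V : lmodType R) x (F : 'I_n -> V) :
  \sum_b \sum_d (gi b d * gm b x) *: F d = F x.
Proof.
rewrite exchange_big -[RHS](sum_dlt x); apply: eq_bigr => d _ /=.
rewrite -scaler_suml /dlt -(gm_gi hcompact x d); congr (_ *: _).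
by apply: eq_bigr => b _; rewrite (gm_sym c x) mulrC.
Qed.

Lemma wdg_gm_contract k (F : 'I_n -> T k) :
  \sum_b \sum_d gi b d *: wdg (gm b) (F d) = \sum_d wdg (dlt d) (F d).
Proof.
under eq_bigr do under eq_bigr do rewrite wdg_dlt scaler_sumr.
under eq_bigr do rewrite exchange_big; rewrite exchange_big; apply: eq_bigr => x _ /=.
rewrite -[RHS](sum_gi_gm x (fun d => wdg (dlt x) (F d))).
by apply: eq_bigr => b _; apply: eq_bigr => d _; rewrite scalerA.
Qed.

Lemma sym_contract0 (V : lmodType R) (g : 'I_n -> 'I_n -> R) (F : 'I_n -> 'I_n -> V) :
  (forall a b, g a b = g b a) -> (forall a b, F a b = - F b a) ->
  \sum_a \sum_b g a b *: F a b = 0.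
Proof.
move=> gs Fs; set S := \sum_a _.
have : S = - S.
  rewrite {1}/S exchange_big -sumrN; apply: eq_bigr => a _; rewrite -sumrN.
  by apply: eq_bigr => b _ /=; rewrite gs Fs scalerN.
move/eqP; rewrite -subr_eq0 opprK -mulr2n -scaler_nat scaler_eq0 pnatr_eq0 /=.
by move=> /eqP.
Qed.

Lemma inn_inn_contract k (A : T k.+2) : alt A ->
  \sum_a \sum_b gi a b *: inn a (inn b A) = 0.
Proof.
move=> hA; apply: sym_contract0 => a b; first exact: gi_sym.
by rewrite (alt_innC a b hA).
Qed.

(** Exchanging the contraction with L costs a contraction with [e_a, e_b], skew in a and b, which
    the symmetric inverse metric kills. *)
Lemma inn_lact_contract k (A : T k.+1) :
  \sum_a \sum_b gi a b *: inn a (lact c b A) = 2 *: del c A.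
Proof.
rewrite /del scalerA mulfV ?pnatr_eq0 // scale1r exchange_big /=.
apply/eqP; rewrite -subr_eq0 -sumrB; apply/eqP.
rewrite -[RHS]oppr0.
rewrite -[X in _ = - X](@sym_contract0 _ gi (fun a b => \sum_m c a b m *: inn m A)).
- rewrite -sumrN; apply: eq_bigr => a _; rewrite -sumrB -sumrN; apply: eq_bigr => b _ /=.
  by rewrite gi_sym inn_lact scalerBr addrAC subrr add0r.
- exact: gi_sym.
- by move=> a b; rewrite (sum_lact_skew hlie).
Qed.

Lemma coact_gm a b x : coact c a (gm b) x = \sum_m c a b m * gm m x.
Proof.
have := gm_inv hlie a b x => /eqP; rewrite addr_eq0 => /eqP ->.
by congr (- _); apply: eq_bigr.
Qed.

Lemma lact_wdg_gm k a b (A : T k) :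
  lact c a (wdg (gm b) A) = wdg (gm b) (lact c a A) + \sum_m c a b m *: wdg (gm m) A.
Proof. by rewrite lact_wdg; congr (_ + _); rewrite -wdg_suml; apply/wdg_eql/coact_gm. Qed.

(** The derivation formula [lact_altE] written in the metric dual frame, after [gi_contract] has
    moved the bracket to the other index. *)
Lemma bracket_contract k a (A : T k.+1) : alt A ->
  \sum_b \sum_d gi b d *: (\sum_m c a b m *: wdg (gm m) (inn d A)) = lact c a A.
Proof.
move=> hA; rewrite (gi_contract hlie hcompact a (fun m d => wdg (gm m) (inn d A))).
have -> : \sum_b \sum_d gi b d *: (\sum_m c a d m *: wdg (gm b) (inn m A)) =
    \sum_d wdg (dlt d) (\sum_m c a d m *: inn m A).
  rewrite -wdg_gm_contract; apply: eq_bigr => b _; apply: eq_bigr => d _.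
  by rewrite wdg_sum; congr (_ *: _); apply: eq_bigr => m _; rewrite wdgZ.
rewrite (lact_altE hlie) // -sumrN.
under [RHS]eq_bigr do rewrite wdg_dlt.
rewrite exchange_big; apply: eq_bigr => d _; rewrite wdg_sum -sumrN; apply: eq_bigr => m _ /=.
by rewrite wdgZ (c_skew hlie) scaleNr opprK.
Qed.

(* Adjoint to Cartan's formula [d i_a + i_a d = - L_a]. *)
Lemma del_wdg_gm k a (A : T k.+1) : alt A ->
  del c (wdg (gm a) A) = lact c a A - wdg (gm a) (del c A).
Proof.
move=> hA; have e2 : 2 != 0 :> R by rewrite pnatr_eq0.
apply: (scalerI e2); rewrite {1}/del scalerA mulfV // scale1r.
(* The first and the third sum are both L_a A, the third one arising from L_b acting on the factor
   dual to e_a. *)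
transitivity (\sum_b \sum_d (gi b d * gm a d) *: lact c b A
  - wdg (gm a) (\sum_b \sum_d gi b d *: lact c b (inn d A))
  + \sum_b \sum_d gi b d *: (\sum_m c a b m *: wdg (gm m) (inn d A))).
  rewrite wdg_sum -sumrB -big_split; apply: eq_bigr => b _.
  rewrite wdg_sum -sumrB -big_split; apply: eq_bigr => d _ /=.
  rewrite inn_wdg lactB lactZ lact_wdg_gm -scalerA wdgZ -scalerBr -scalerDr; congr (_ *: _).
  rewrite opprD addrA; congr (_ + _); rewrite -sumrN; apply: eq_bigr => m _.
  by rewrite (c_skew hlie) scaleNr opprK.
rewrite bracket_contract // scalerBr [X in X - _ + _ = _](_ : _ = lact c a A); last first.
  rewrite exchange_big /= -[RHS](sum_gi_gm a (fun b => lact c b A)).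
  apply: eq_bigr => d _; apply: eq_bigr => b _ /=.
  by rewrite gi_sym (gm_sym c a).
rewrite -wdgZ /del scalerA mulfV // scale1r.
by tensor_ring.
Qed.

Lemma trace_contract : \sum_b \sum_d gi b d * gm b d = n%:R.
Proof.
transitivity (\sum_(b < n) (1 : R)); last by rewrite sumr_const card_ord.
apply: eq_bigr => b _; transitivity ((b == b)%:R : R); last by rewrite eqxx.
rewrite -(gm_gi hcompact b b).
by apply: eq_bigr => d _; rewrite mulrC (gi_sym c b).
Qed.

(* If [L_a beta = e_a ^ x] for all [a], then evaluating [[L_a, L_b] = L_[a, b]]
   on [beta] and contracting over [b] leaves [(n - 3) L_a x = 0]. *)
Lemma twisted_invariant (beta : T 2) (x : T 1) : n != 3 ->
  (forall a, lact c a beta = wdg (gm a) x) -> forall a, lact c a x = 0.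
Proof.
move=> n3 h a.
have key b : wdg (gm b) (lact c a x) - wdg (gm a) (lact c b x)
    + \sum_m c a b m *: wdg (gm m) x = 0.
  have := lact_comm hlie a b beta; rewrite !h !lact_wdg_gm.
  rewrite [X in _ = X](eq_bigr (fun m => c a b m *: wdg (gm m) x)) => [|m _]; last by rewrite h.
  have -> : \sum_m c b a m *: wdg (gm m) x = - \sum_m c a b m *: wdg (gm m) x.
    by rewrite -sumrN; apply: eq_bigr => m _; rewrite (c_skew hlie) scaleNr.
  move=> /eqP; rewrite -subr_eq0 => /eqP e; rewrite -[RHS]e; tensor_ring.
have c1 : \sum_b \sum_d gi b d *: inn d (wdg (gm b) (lact c a x)) =
    n%:R *: lact c a x - lact c a x.
  rewrite -trace_contract scaler_suml.
  have := wdg_gm_contract (fun d => inn d (lact c a x)).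
  rewrite (wdg_inn_degree (alt_deg1 _)) scale1r => e; rewrite -[X in _ = _ - X]e.
  rewrite -sumrB; apply: eq_bigr => b _; rewrite scaler_suml -sumrB; apply: eq_bigr => d _.
  by rewrite inn_wdg scalerBr scalerA.
have c2 : \sum_b \sum_d gi b d *: inn d (wdg (gm a) (lact c b x)) = lact c a x.
  have d0 : del c x = 0.
    by rewrite /del !big1 ?scaler0 // => b _; rewrite big1 // => d _; rewrite lact0E scaler0.
  have z : wdg (gm a) (\sum_d \sum_b gi d b *: inn d (lact c b x)) = 0.
    by rewrite inn_lact_contract d0 scaler0 wdg0.
  rewrite -[RHS]subr0 -[X in _ = _ - X]z exchange_big /=.
  rewrite -[X in _ = X - _](sum_gi_gm a (fun b => lact c b x)).
  rewrite wdg_sum -sumrB; apply: eq_bigr => d _; rewrite wdg_sum -sumrB; apply: eq_bigr => b _.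
  by rewrite inn_wdg scalerBr scalerA wdgZ (gm_sym c a d) (gi_sym c b d).
have c3 : \sum_b \sum_d gi b d *: inn d (\sum_m c a b m *: wdg (gm m) x) = - lact c a x.
  transitivity (\sum_b \sum_d gi b d *: ((\sum_m c a b m * gm m d) *: x)
     - \sum_b \sum_d gi b d *: (\sum_m c a b m *: wdg (gm m) (inn d x))).
    rewrite -sumrB; apply: eq_bigr => b _; rewrite -sumrB; apply: eq_bigr => d _.
    rewrite -scalerBr inn_sum; congr (_ *: _); rewrite scaler_suml -sumrB; apply: eq_bigr => m _.
    by rewrite innZ inn_wdg scalerBr scalerA.
  rewrite bracket_contract; last exact: alt_deg1.
  rewrite sym_contract0 ?sub0r //; first exact: gi_sym.
  move=> b d; rewrite -scaleNr; congr (_ *: _).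
  have := gm_inv hlie a b d => /eqP; rewrite addr_eq0 => /eqP ->; congr (- _).
  by apply: eq_bigr => m _; rewrite gm_sym.
(* Contracting [key] over b, its three terms contribute n - 1, -1 and -1 times L_a x. *)
have : n%:R *: lact c a x - lact c a x - lact c a x - lact c a x = 0.
  transitivity (n%:R *: lact c a x - lact c a x - (lact c a x) + (- lact c a x)) => //.
  rewrite -[X in X - _ + _]c1 -[X in _ - X + _]c2 -[X in _ + X]c3 -sumrB -big_split big1 // => b _.
  rewrite -sumrB -big_split big1 // => d _ /=.
  by rewrite -scalerBr -scalerDr -innB -innD key inn0 scaler0.
have -> : n%:R *: lact c a x - lact c a x - lact c a x - lact c a x = (n%:R - 3) *: lact c a x.
  by tensor_ring.
move/eqP; rewrite scaler_eq0 subr_eq0 eqr_nat (negPf n3) /=.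
by move=> /eqP.
Qed.

Lemma coclosed_wedges_eq0 (beta : T 2) : n != 3 -> alt beta ->
  (forall a, del c (wdg (gm a) beta) = 0) -> beta = 0.
Proof.
move=> n3 hb h.
have h1 a : lact c a beta = wdg (gm a) (del c beta).
  by apply/eqP; rewrite -subr_eq0 -del_wdg_gm // h.
have x0 : del c beta = 0 by apply: (invariant_deg1 hlie hcompact); apply: twisted_invariant h1.
by apply: (invariant_deg2 hlie hcompact) => // a; rewrite h1 x0 wdg0.
Qed.

Lemma innv_gm k a (A : T k.+1) : innv c (gm a) A = inn a A.
Proof.
rewrite -[RHS](sum_gi_gm a (fun d => inn d A)); apply: eq_bigr => b _.
by apply: eq_bigr => d _; rewrite mulrC (gm_sym c a).
Qed.

Definition unit0 : T 0 := [ffun=> 1].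

(** Writes a one-form as an exterior multiplication applied to 1, so that [wdgC] can reorder it. *)
Lemma deg1_wdg (A : T 1) : A = wdg (fun a => A [ffun=> a]) unit0.
Proof.
apply: inn_ext => a; apply/ffunP => u; rewrite inn_wdg0 tens_scaleE ffunE mulr1 innE.
by congr (A _); apply/ffunP => i; rewrite (ord1 i) tcons0 ffunE.
Qed.

(** [wdg_inn_degree] in degrees 3 and 2 expands omega over the coframe; this is the origin of 6 = 3
    * 2. *)
Lemma omega_coframe :
  \sum_a \sum_e wdg (gm a) (wdg (dlt e) (wdg (coact c e (dlt a)) unit0)) = 6 *: omega c.
Proof.
have hO := alt_omega hlie.
have i2 x y : inn y (inn x (omega c)) = - \sum_k gm x k *: wdg (fun z => c y z k) unit0.
  apply: inn_ext => z; apply/ffunP => u; rewrite inn_omega innN inn_sum tens_oppE sum_ffunE -sumrN.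
  apply: eq_bigr => k _; rewrite innZ inn_wdg0 !tens_scaleE ffunE mulr1 mulrC.
  by rewrite /metric mulNr opprK.
have -> : 6 *: omega c = 2 *: (3 *: omega c) by rewrite scalerA -natrM.
rewrite -(wdg_inn_degree hO) scaler_sumr.
rewrite [RHS](eq_bigr (fun x => \sum_y \sum_k
    gm x k *: - wdg (dlt x) (wdg (dlt y) (wdg (fun z => c y z k) unit0)))); last first.
  move=> x _; rewrite -wdgZ -(wdg_inn_degree (alt_inn x hO)) wdg_sum; apply: eq_bigr => y _.
  rewrite i2 wdgN wdg_sum wdgN wdg_sum -sumrN; apply: eq_bigr => k _.
  by rewrite !wdgZ scalerN.
rewrite [RHS]exchange_big [LHS]exchange_big; apply: eq_bigr => y _ /=.
rewrite [RHS]exchange_big; apply: eq_bigr => k _ /=.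
rewrite [LHS]wdg_dlt; apply: eq_bigr => x _; rewrite (gm_sym c k); congr (_ *: _).
rewrite -2!wdgN -wdg_opp; congr wdg; congr wdg; apply: wdg_eql => z.
by congr (- _); rewrite -[RHS](sum_delta k (fun m => c y z m)); apply: eq_bigr => m _; rewrite mulrC.
Qed.

(** After multiplication by -2, d becomes the sum of e^e /\ L_e. The terms with L_e on [A] vanish,
    as the sum of the dual of e_a wedge e^a is zero by symmetry of the metric ([z]); those with L_e
    on e^a give -6 times [A] wedge omega. *)
Lemma wdg_dif_coframe (A : T 1) :
  \sum_a wdg (gm a) (dif c (wdg (dlt a) A)) = 3 *: wdg (fun a => A [ffun=> a]) (omega c).
Proof.
set f : 'I_n -> R := fun a => A [ffun=> a]; have eA : A = wdg f unit0 by exact: deg1_wdg.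
have e2 : 2 != 0 :> R by rewrite pnatr_eq0.
apply: (scalerI (a := -2)); first by rewrite oppr_eq0.
transitivity (\sum_e - wdg (dlt e) (\sum_a wdg (gm a) (wdg (dlt a) (lact c e A)))
   + \sum_a \sum_e wdg (gm a) (wdg (dlt e) (wdg (coact c e (dlt a)) A))).
  rewrite [X in _ = _ + X]exchange_big scaler_sumr /=.
  rewrite (eq_bigr (fun a => \sum_e wdg (gm a) (wdg (dlt e) (lact c e (wdg (dlt a) A))))).
    rewrite exchange_big -big_split; apply: eq_bigr => e _ /=.
    rewrite wdg_sum -sumrN -big_split; apply: eq_bigr => a _ /=.
    rewrite lact_wdg !wdgD; congr (_ + _).
    exact: wdgC.
  move=> a _; rewrite -wdgZ -(wdg_lact_dif hlie); last exact/alt_wdg/alt_deg1.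
  by rewrite wdg_sum.
have z B : \sum_a wdg (gm a) (wdg (dlt a) B) = 0 :> T 3.
  rewrite -[RHS](@sym_contract0 _ gm (fun a b => wdg (dlt b) (wdg (dlt a) B))).
  - by apply: eq_bigr => a _; rewrite wdg_dlt.
  - exact: gm_sym.
  - by move=> a b; rewrite wdgC.
rewrite big1 => [|e _]; last by rewrite z wdg0 oppr0.
rewrite add0r.
transitivity (- wdg f (\sum_a \sum_e wdg (gm a) (wdg (dlt e) (wdg (coact c e (dlt a)) unit0)))).
  rewrite wdg_sum -sumrN; apply: eq_bigr => a _; rewrite wdg_sum -sumrN; apply: eq_bigr => e _.
  rewrite eA [wdg (coact _ _ _) _]wdgC wdgN wdgN [wdg (dlt e) _]wdgC wdgN opprK.
  by rewrite wdgC.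
by rewrite omega_coframe wdgZ scalerA -scaleNr mulNr -natrM.
Qed.

End Contractions.

(** * The operators on g (x) g^perp and the five assertions *)

Section TensorProduct.
Variables (R : rcfType) (n : nat) (c : 'I_n -> 'I_n -> 'I_n -> R).
Hypotheses (hlie : is_lie_algebra c) (hcompact : is_compact c).
Local Notation gm := (metric c).
Local Notation gi := (metric_inv c).
Local Notation T k := (Tens R n k).
Local Notation dlt := (dlt R).
Local Notation GT := (GT R n).

Definition mkGT (F : 'I_n -> T 2) : GT := [ffun p => F p.1 p.2].

Lemma slice_mkGT F a : slice (mkGT F) a = F a.
Proof. by apply/ffunP => t; rewrite !ffunE. Qed.

Lemma GT_ext (P Q : GT) : (forall a, slice P a = slice Q a) -> P = Q.
Proof.
move=> h; apply/ffunP => -[a t]; have := congr1 (fun A : T 2 => A t) (h a).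
by rewrite !ffunE.
Qed.

Lemma slice_lin x (P Q : GT) a : slice (x *: P + Q) a = x *: slice P a + slice Q a.
Proof. by apply/ffunP => t; rewrite !ffunE. Qed.

Lemma slice0 a : slice (0 : GT) a = 0.
Proof. by apply/ffunP => t; rewrite !ffunE. Qed.

Lemma slice_act i (P : GT) a :
  slice (actGT c i P) a = \sum_b c i b a *: slice P b + lact c i (slice P a).
Proof.
apply/ffunP => t; rewrite tens_addE lact_actk sum_ffunE ffunE [LHS]ffunE /=.
congr (_ + _); by apply: eq_bigr => b _; rewrite tens_scaleE ffunE.
Qed.

(** [Dp] and [Dm] are D_+ and D_- after the substitution of [rho_omega]. They agree with the given
    operators on [ggperp], while linearity and equivariance hold on all of [GT]. *)
Definition Dp (P : GT) : T 4 := - \sum_a wdg (gm a) (dif c (slice P a)).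
Definition Dm (P : GT) : T 2 := - \sum_a inn a (dif c (slice P a)).

Lemma Dp_lin x P Q : Dp (x *: P + Q) = x *: Dp P + Dp Q.
Proof.
rewrite scalerN scaler_sumr -opprD -big_split; congr (- _); apply: eq_bigr => a _ /=.
by rewrite slice_lin difD difZ wdgD wdgZ.
Qed.

Lemma Dm_lin x P Q : Dm (x *: P + Q) = x *: Dm P + Dm Q.
Proof.
rewrite scalerN scaler_sumr -opprD -big_split; congr (- _); apply: eq_bigr => a _ /=.
by rewrite slice_lin difD difZ innD innZ.
Qed.

(** The action on the g-factor supplies exactly the commutator of L_i with exterior multiplication
    by the dual of e_a; in [Dm_act] it supplies the commutator with i_a. *)
Lemma Dp_act i P : Dp (actGT c i P) = lact c i (Dp P).
Proof.
rewrite lactN lact_sum; congr (- _).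
transitivity (\sum_a \sum_b c i b a *: wdg (gm a) (dif c (slice P b))
   + \sum_a wdg (gm a) (lact c i (dif c (slice P a)))).
  rewrite -big_split; apply: eq_bigr => a _ /=.
  rewrite slice_act difD dif_sum wdgD wdg_sum -(lact_dif hlie); congr (_ + _).
  by apply: eq_bigr => b _; rewrite difZ wdgZ.
rewrite exchange_big -big_split; apply: eq_bigr => b _ /=.
by rewrite (lact_wdg_gm hlie) addrC.
Qed.

Lemma Dm_act i P : Dm (actGT c i P) = lact c i (Dm P).
Proof.
rewrite lactN lact_sum; congr (- _).
transitivity (\sum_a \sum_b c i b a *: inn a (dif c (slice P b))
   + \sum_a inn a (lact c i (dif c (slice P a)))).
  rewrite -big_split; apply: eq_bigr => a _ /=.
  rewrite slice_act difD dif_sum innD inn_sum -(lact_dif hlie); congr (_ + _).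
  by apply: eq_bigr => b _; rewrite difZ innZ.
rewrite exchange_big -big_split; apply: eq_bigr => b _ /=.
by rewrite lact_inn addrC.
Qed.

Lemma ggperpP P : ggperp c P <-> forall a, alt (slice P a) /\ del c (slice P a) = 0.
Proof. by split=> h a; apply/(gperp_del hlie hcompact). Qed.

Lemma flat_ebasis a b : flat c (ebasis R a) [ffun=> b] = gm a b.
Proof.
rewrite ffunE -[RHS](sum_delta a (fun x => gm x b)); apply: eq_bigr => x _.
by rewrite !ffunE.
Qed.

Lemma DplusE P : ggperp c P -> Dplus c P = Dp P.
Proof.
move=> /ggperpP h; rewrite /Dp -sumrN; apply: eq_bigr => a _; have [ha _] := h a.
rewrite (rho_omega hlie hcompact ha) wedge1E; last exact/altN/alt_dif.
by rewrite wdgN (wdg_eql _ (flat_ebasis a)).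
Qed.

Lemma DminusE P : ggperp c P -> Dminus c P = Dm P.
Proof.
move=> /ggperpP h; rewrite /Dm -sumrN; apply: eq_bigr => a _; have [ha _] := h a.
rewrite (rho_omega hlie hcompact ha) -innN; apply/ffunP => t.
rewrite ffunE innE -[RHS](sum_delta a (fun b => (- dif c (slice P a)) (tcons b t))).
by apply: eq_bigr => x _; rewrite ffunE.
Qed.

Lemma WharE P : Whar c P <-> [/\ ggperp c P, Dp P = 0 & Dm P = 0].
Proof.
by split=> -[h]; [rewrite DplusE ?DminusE | split; rewrite ?DplusE ?DminusE].
Qed.

Lemma gperp_submod : submod (@actk R n c 2) (gperp c).
Proof.
split; first split.
- by apply/(gperp_del hlie hcompact); rewrite delr0; split=> //; case: (@alt_subspace R n 2).
- move=> a x y /(gperp_del hlie hcompact)[hx dx] /(gperp_del hlie hcompact)[hy dy].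
  apply/(gperp_del hlie hcompact); rewrite delD delZ dx dy scaler0 addr0; split=> //.
  by apply: altD => //; apply: altZ.
move=> i x /(gperp_del hlie hcompact)[hx dx]; apply/(gperp_del hlie hcompact).
by rewrite -lact_actk -(lact_del hlie hcompact) dx lact0; split=> //; apply: alt_lact.
Qed.

Lemma ggperp_submod : submod (actGT c) (ggperp c).
Proof.
have [gsub gact] := gperp_submod; split; first split.
- by move=> a; rewrite slice0; case: gsub.
- by move=> x P Q hP hQ a; rewrite slice_lin; case: gsub => _; apply.
move=> i P hP a; rewrite slice_act; apply: (subspaceD gsub).
  by apply: (subspace_sum gsub) => b; apply: (subspaceZ _ gsub).
by rewrite lact_actk; apply: gact.
Qed.

Lemma Whar_submod : submod (actGT c) (Whar c).
Proof.
have [[g0 gl] ga] := ggperp_submod; split; first split.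
- apply/WharE; split=> //; rewrite /Dp /Dm big1 ?oppr0 // => a _; rewrite slice0 difr0.
    exact: wdg0.
  exact: inn0.
- move=> x P Q /WharE[hP pP mP] /WharE[hQ pQ mQ]; apply/WharE; split; first exact: gl.
    by rewrite Dp_lin pP pQ scaler0 addr0.
  by rewrite Dm_lin mP mQ scaler0 addr0.
move=> i P /WharE[hP pP mP]; apply/WharE; split; first exact: ga.
  by rewrite Dp_act pP lact0.
by rewrite Dm_act mP lact0.
Qed.

Lemma ipGTE (P Q : GT) :
  ipGT c P Q = \sum_a \sum_b gm a b * ip c (slice P a) (slice Q b).
Proof. by apply: eq_bigr => a _; apply: eq_bigr => b _; rewrite ip_ipk. Qed.

Lemma ipGTC P Q : ipGT c P Q = ipGT c Q P.
Proof.
rewrite !ipGTE exchange_big; apply: eq_bigr => a _; apply: eq_bigr => b _ /=.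
by rewrite gm_sym (ipC c).
Qed.

Lemma ipGT_lin a P Q S : ipGT c (a *: P + Q) S = a * ipGT c P S + ipGT c Q S.
Proof.
rewrite !ipGTE mulr_sumr -big_split; apply: eq_bigr => i _ /=.
rewrite mulr_sumr -big_split; apply: eq_bigr => j _ /=.
by rewrite slice_lin (ip_lin c); ring.
Qed.

Lemma ipGT_gt0 P : P != 0 -> 0 < ipGT c P P.
Proof.
move=> nz; rewrite ipGTE.
have [a ha] : exists a, slice P a != 0.
  apply/existsP; apply: contraNT nz; rewrite negb_exists => /forallP h.
  by apply/eqP/GT_ext => a; rewrite slice0; apply/eqP; move: (h a); exact: negbNE.
have := @posdef_sum R n (gmx c) _ (@ip R n c 2) (fun A B => @ipC R n c 2 A B)
  (@ip_lin R n c 2) (@ip_gt0 R n c hcompact 2)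
  (gmx_sym c) (gmx_posdef hcompact) (slice P) (ex_intro _ a ha).
congr (_ < _); apply: eq_bigr => i _; apply: eq_bigr => j _; by rewrite mxE.
Qed.

Lemma ipGT_act i P Q : ipGT c (actGT c i P) Q = - ipGT c P (actGT c i Q).
Proof.
apply/eqP; rewrite -addr_eq0 !ipGTE; apply/eqP.
transitivity (\sum_e \sum_b (\sum_a c i e a * gm a b + \sum_a c i b a * gm e a)
    * ip c (slice P e) (slice Q b)); last first.
  by rewrite big1 // => e _; rewrite big1 // => b _; rewrite (gm_inv hlie) mul0r.
transitivity (\sum_a \sum_b \sum_e gm a b * (c i e a * ip c (slice P e) (slice Q b))
  + \sum_a \sum_b \sum_e gm a b * (c i e b * ip c (slice P a) (slice Q e))).
  rewrite -!big_split; apply: eq_bigr => a _; rewrite -!big_split; apply: eq_bigr => b _ /=.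
  rewrite !slice_act ipDl ipDr ip_suml ip_sumr (ip_lact hlie hcompact).
  rewrite (eq_bigr _ (fun e _ => ipZl (k:=2) c (c i e a) (slice P e) (slice Q b))).
  rewrite [in X in _ + X](eq_bigr _ (fun e _ => ipZr (k:=2) c (c i e b) (slice P a) (slice Q e))).
  by rewrite -!mulr_sumr; ring.
transitivity (\sum_e \sum_b (\sum_a c i e a * gm a b) * ip c (slice P e) (slice Q b)
   + \sum_e \sum_b (\sum_a c i b a * gm e a) * ip c (slice P e) (slice Q b)); last first.
  rewrite -big_split; apply: eq_bigr => e _; rewrite -big_split; apply: eq_bigr => b _ /=.
  by rewrite mulrDl.
congr (_ + _).
  under eq_bigr do rewrite exchange_big; rewrite exchange_big; apply: eq_bigr => e _ /=.
  rewrite exchange_big; apply: eq_bigr => b _; rewrite mulr_suml; apply: eq_bigr => a _.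
  by rewrite mulrCA mulrA.
apply: eq_bigr => a _; rewrite exchange_big; apply: eq_bigr => e _ /=.
by rewrite mulr_suml; apply: eq_bigr => b _; rewrite mulrCA mulrA.
Qed.

Lemma WperpPlusE P : WperpPlus c P <->
  [/\ ggperp c P, Dp P = 0 & forall w, Whar c w -> ipGT c P w = 0].
Proof. by split=> -[h h1 h2]; split; rewrite // -?h1 DplusE. Qed.

Lemma WperpMinusE P : WperpMinus c P <->
  [/\ ggperp c P, Dm P = 0 & forall w, Whar c w -> ipGT c P w = 0].
Proof. by split=> -[h h1 h2]; split; rewrite // -?h1 DminusE. Qed.

Lemma decomposition : exists (m : nat) (V : 'I_m -> GT -> Prop),
  [/\ forall i, [/\ irreducible (actGT c) (V i),
                     forall x, V i x -> ggperp c x &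
                     exists U : L24 R n -> Prop,
                       [/\ irreducible (act24 c) U,
                           forall p, U p -> inL24 p &
                           gmod_iso (actGT c) (act24 c) (V i) U]],
      forall x, ggperp c x <->
        exists (w : GT) (v : 'I_m -> GT),
          [/\ Whar c w, forall i, V i (v i) & x = w + \sum_i v i] &
      forall (w : GT) (v : 'I_m -> GT),
        Whar c w -> (forall i, V i (v i)) -> w + \sum_i v i = 0 ->
        w = 0 /\ forall i, v i = 0].
Proof.
have hg := ggperp_submod; have hW := Whar_submod.
have hC := submod_perp ipGT_lin ipGT_act hg hW.
have [m [V [irrV decV indV]]] := submod_decomposition ipGTC ipGT_lin ipGT_gt0 ipGT_act hC.
exists m, V; split.
- move=> i; have [irr VC] := irrV i; split=> // [x /VC[]//|].
  pose f (P : GT) : L24 R n := (Dm P, Dp P).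
  have [|||irrU isoU] := @irreducible_image R n GT (L24 R n) (actGT c) (act24 c) (V i) f _ _ _ irr.
  + by move=> a x y; rewrite /f Dm_lin Dp_lin.
  + by move=> j x _; rewrite /f /act24 Dm_act Dp_act !lact_actk.
  + move=> x /VC[gx hx] [m0 p0]; apply: (form_eq0 ipGT_gt0); apply: hx.
    exact/WharE.
  exists (fun y => exists2 x, V i x & f x = y); split=> // _ [x /VC[/ggperpP gx _] <-].
  split; apply: altN; apply: alt_sum => a; have [ha _] := gx a.
    exact/alt_inn/alt_dif.
  exact/alt_wdg/alt_dif.
- move=> x; split=> [gx|[w [v [/WharE[gw _ _] Vv ->]]]].
    have [w Ww hw] := subspace_proj ipGTC ipGT_lin ipGT_gt0 x hW.1.
    have [|v Vv e] := decV (x - w).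
      by split=> //; apply: (subspaceB hg.1) => //; case/WharE: Ww.
    by exists w, v; split=> //; rewrite -e addrC subrK.
  apply: (subspaceD hg.1) => //; apply: (subspace_sum hg.1) => i.
  by case: ((irrV i).2 _ (Vv i)).
move=> w v Ww Vv e0.
have [_ hperp] : ggperp c (\sum_i v i) /\ forall t, Whar c t -> ipGT c (\sum_i v i) t = 0.
  by apply: (subspace_sum hC.1) => i; apply: (irrV i).2.
have w0 : w = 0.
  apply: (form_eq0 ipGT_gt0); have := form_0l ipGT_lin w.
  by rewrite -e0 (form_Dl ipGT_lin) hperp // addr0.
by split=> //; apply: indV => //; rewrite w0 add0r in e0.
Qed.

Lemma Dminus_surjective : n != 3 ->
  forall beta : T 2, alt beta -> exists x, ggperp c x /\ Dminus c x = beta.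
Proof.
move=> n3.
have h0 : subspace (fun y : T 2 => exists x, ggperp c x /\ Dm x = y).
  have [[g0 gl] _] := ggperp_submod; split.
    by exists 0; split=> //; have [_ _] := (WharE 0).1 Whar_submod.1.1.
  move=> a _ _ [x [gx <-]] [y [gy <-]]; exists (a *: x + y); split; first exact: gl.
  exact: Dm_lin.
have h := subspace_full (fun A B => @ipC R n c 2 A B) (@ip_lin R n c 2) (@ip_gt0 R n c hcompact 2)
  (@alt_subspace R n 2) h0.
move=> beta hb; have [|y hy hperp|x [gx e]] := h _ _ beta hb; last first.
- by exists x; rewrite DminusE.
- apply: (coclosed_wedges_eq0 hlie hcompact n3 hy) => a.
  (* Tested against e_a (x) s, which lies in g (x) g^perp because delta delta = 0: the pairing of
     [y] with its image under D_- is minus the squared norm of [s]. *)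
  set s := del c _; have hw : alt (wdg (gm a) y) by apply: alt_wdg.
  have hs : alt s by apply: alt_del.
  pose P := mkGT (fun b => dlt a b *: s).
  have gP : ggperp c P.
    apply/ggperpP => b; rewrite slice_mkGT delZ /s (del_del hlie hcompact hw) scaler0.
    by split=> //; apply: altZ.
  have eP : Dm P = - inn a (dif c s).
    rewrite /Dm -[in RHS](sum_dlt a (fun b => inn b (dif c s))); congr (- _).
    apply: eq_bigr => b _; rewrite slice_mkGT difZ innZ; congr (_ *: _).
    by rewrite /dlt eq_sym.
  have := hperp (Dm P) (ex_intro _ P (conj gP erefl)).
  rewrite eP -scaleN1r ipZr -(innv_gm hcompact) -(ip_wdg c); last exact: alt_dif.
  rewrite (ipC c) (ip_dif hlie hcompact) // -/s => e.
  apply: (ip_eq0 hcompact); lra.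
move=> _ [x [/ggperpP gx <-]]; apply: altN; apply: alt_sum => a.
by have [ha _] := gx a; apply/alt_inn/alt_dif.
Qed.

Lemma Dplus_omega (theta : T 1) :
  exists x, ggperp c x /\ Dplus c x = wedge (omega c) theta.
Proof.
(* The factor 1/3 cancels the 3 of [wdg_dif_coframe]; the projection is invisible to D_+ because it
   changes each slice by an exact form. *)
pose P := mkGT (fun a => 3^-1 *: coclosed_proj c (wdg (dlt a) theta)).
have ha a : alt (wdg (dlt a) theta) by apply/alt_wdg/alt_deg1.
have gP : ggperp c P.
  apply/ggperpP => a; rewrite slice_mkGT delZ (del_coclosed_proj hlie hcompact) scaler0.
  by split=> //; apply/altZ/coclosed_proj_alt.
exists P; split=> //; rewrite DplusE // wedge31E; last exact: alt_omega.
rewrite /Dp; congr (- _).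
transitivity (3^-1 *: \sum_a wdg (gm a) (dif c (wdg (dlt a) theta))).
  rewrite scaler_sumr; apply: eq_bigr => a _.
  by rewrite slice_mkGT difZ (dif_coclosed_proj hlie) wdgZ.
by rewrite (wdg_dif_coframe hlie) scalerA mulVf ?scale1r // pnatr_eq0.
Qed.

(* Raises the index of a family of 2-forms to get an element of g (x) Lambda^2. *)
Definition raise (F : 'I_n -> T 2) : GT := mkGT (fun a => \sum_b gi a b *: F b).

Lemma slice_raise F a : slice (raise F) a = \sum_b gi a b *: F b.
Proof. exact: slice_mkGT. Qed.

Lemma ggperp_raise F : (forall b, gperp c (F b)) -> ggperp c (raise F).
Proof.
have [gsub _] := gperp_submod.
by move=> h a; rewrite slice_raise; apply: (subspace_sum gsub) => b; apply: subspaceZ.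
Qed.

Lemma Dp_raise F : Dp (raise F) = - \sum_b wdg (dlt b) (dif c (F b)).
Proof.
rewrite -(wdg_gm_contract hcompact); congr (- _); apply: eq_bigr => a _.
by rewrite slice_raise dif_sum wdg_sum; apply: eq_bigr => b _; rewrite difZ wdgZ.
Qed.

Lemma Dm_raise F : Dm (raise F) = - \sum_a \sum_b gi a b *: inn a (dif c (F b)).
Proof.
congr (- _); apply: eq_bigr => a _.
by rewrite slice_raise dif_sum inn_sum; apply: eq_bigr => b _; rewrite difZ innZ.
Qed.

Lemma ipGT_raise F Q : ipGT c (raise F) Q = \sum_b ip c (F b) (slice Q b).
Proof.
rewrite ipGTE.
transitivity (\sum_b \sum_e (\sum_a gi e a * gm a b) * ip c (F e) (slice Q b)).
  rewrite exchange_big; apply: eq_bigr => b _ /=.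
  transitivity (\sum_a \sum_e gm a b * (gi a e * ip c (F e) (slice Q b))).
    apply: eq_bigr => a _; rewrite slice_raise ip_suml mulr_sumr; apply: eq_bigr => e _.
    by rewrite ipZl.
  rewrite exchange_big; apply: eq_bigr => e _; rewrite mulr_suml; apply: eq_bigr => a _ /=.
  by rewrite mulrA [gm a b * _]mulrC (gi_sym c a).
apply: eq_bigr => b _; rewrite -[RHS](sum_delta b (fun e => ip c (F e) (slice Q b))).
by apply: eq_bigr => e _; rewrite gi_gm.
Qed.

Definition grad (tau : T 2) : GT := raise (fun b => lact c b tau).

Lemma gperp_lact b tau : gperp c tau -> gperp c (lact c b tau).
Proof. by move=> h; rewrite lact_actk; apply: gperp_submod.2. Qed.

(** As d commutes with L_b, the image is minus the sum of e^b /\ L_b d tau, which is 2 d d tau. *)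
Lemma Dp_grad tau : alt tau -> Dp (grad tau) = 0.
Proof.
move=> ht; rewrite Dp_raise; under eq_bigr do rewrite -(lact_dif hlie).
by rewrite (wdg_lact_dif hlie) ?dif_dif ?scaler0 ?oppr0 //; apply: alt_dif.
Qed.

(** The contraction of i_a L_b d tau is 2 delta d tau, and Cas = -2 delta d on coclosed forms. *)
Lemma Dm_grad tau : del c tau = 0 -> Dm (grad tau) = cas c tau.
Proof.
move=> dt; rewrite Dm_raise (cas_del_free hlie dt) scaleNr -(inn_lact_contract hlie).
by congr (- _); apply: eq_bigr => a _; apply: eq_bigr => b _; rewrite (lact_dif hlie).
Qed.

Lemma grad_lin a x y : grad (a *: x + y) = a *: grad x + grad y.
Proof.
apply: GT_ext => b; rewrite slice_lin !slice_raise scaler_sumr -big_split.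
by apply: eq_bigr => e _ /=; rewrite lactD lactZ scalerDr !scalerA mulrC.
Qed.

Lemma grad_act i tau : actGT c i (grad tau) = grad (lact c i tau).
Proof.
apply: GT_ext => a; rewrite slice_act !slice_raise.
transitivity (\sum_d (\sum_b c i b a * gi b d + \sum_b c i b d * gi a b) *: lact c d tau
   + \sum_b gi a b *: lact c b (lact c i tau)); last first.
  by rewrite big1 ?add0r // => d _; rewrite (gi_inv hlie hcompact) scale0r.
rewrite (eq_bigr (fun b => \sum_d (c i b a * gi b d) *: lact c d tau)) => [|b _]; last first.
  by rewrite slice_raise scaler_sumr; apply: eq_bigr => d _; rewrite scalerA.
under [in RHS]eq_bigr do rewrite scalerDl.
rewrite big_split -addrA; congr (_ + _).
  by rewrite exchange_big; apply: eq_bigr => d _; rewrite scaler_suml.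
rewrite [X in _ = X + _](eq_bigr (fun d => \sum_b (c i b d * gi a b) *: lact c d tau)) => [|d _]; last first.
  by rewrite scaler_suml.
rewrite [X in _ = X + _]exchange_big -big_split lact_sum; apply: eq_bigr => b _ /=.
rewrite lactZ -[lact c i (lact c b tau)](subrK (lact c b (lact c i tau))) (lact_comm hlie).
rewrite scalerDr scaler_sumr; congr (_ + _); apply: eq_bigr => d _.
by rewrite scalerA mulrC.
Qed.

(** By skewness L_b moves to [w]. Cartan's formula turns the sum of L_b w_b into D_- w minus an
    exact form; the first vanishes on W_har, the second is orthogonal to the coclosed tau. *)
Lemma grad_perp tau w : gperp c tau -> Whar c w -> ipGT c (grad tau) w = 0.
Proof.
move=> /(gperp_del hlie hcompact)[ht dt] /WharE[/ggperpP gw _ mw].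
rewrite ipGT_raise.
transitivity (- ip c tau (\sum_b lact c b (slice w b))).
  by rewrite ip_sumr -sumrN; apply: eq_bigr => b _; rewrite (ip_lact hlie hcompact).
have -> : \sum_b lact c b (slice w b) = Dm w - dif c (\sum_b inn b (slice w b)).
  rewrite /Dm -opprD dif_sum -big_split -sumrN; apply: eq_bigr => b _ /=.
  by rewrite inn_dif; tensor_ring.
rewrite mw sub0r -scaleN1r ipZr (ipC c) (ip_dif hlie hcompact) //; last exact: alt_deg1.
by rewrite dt ip0r mulr0 oppr0.
Qed.

Lemma WperpPlus_gperp : exists U : GT -> Prop,
  [/\ submod (actGT c) U, forall x, U x -> WperpPlus c x &
      gmod_iso (actGT c) (@actk R n c 2) U (gperp c)].
Proof.
have [gsub gact] := gperp_submod.
have cas_gperp tau : gperp c tau -> gperp c (cas c tau).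
  move=> h; apply: (subspace_sum gsub) => a; apply: (subspace_sum gsub) => b.
  by apply: subspaceZ => //; do 2!apply: gperp_lact.
have cas0 tau : gperp c tau -> cas c tau = 0 -> tau = 0.
  move=> /(gperp_del hlie hcompact)[ht _] e.
  apply: (invariant_deg2 hlie hcompact) => //.
  by apply: (ip_cas_eq0 hlie hcompact); rewrite e ip0r.
have DmE tau : gperp c tau -> Dm (grad tau) = cas c tau.
  by move=> /(gperp_del hlie hcompact)[_ dt]; apply: Dm_grad.
exists (fun P => exists2 tau, gperp c tau & P = grad tau); split.
- split; first split.
  + exists 0; first by case: gsub.
    apply: GT_ext => a; rewrite slice0 slice_raise big1 // => b _; by rewrite lact0 scaler0.
  + move=> a _ _ [x gx ->] [y gy ->]; exists (a *: x + y); last by rewrite grad_lin.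
    by case: gsub => _; apply.
  + by move=> i _ [x gx ->]; exists (lact c i x); [apply: gperp_lact | rewrite grad_act].
- move=> _ [tau gt ->]; have [ht _] := (gperp_del hlie hcompact tau).1 gt.
  apply/WperpPlusE; split.
  + by apply: ggperp_raise => b; apply: gperp_lact.
  + exact: Dp_grad.
  + by move=> w; apply: grad_perp.
(* The isomorphism goes from the image of [grad] back to g^perp, where it becomes the Casimir
   operator. *)
exists Dm; split.
- exact: Dm_lin.
- by move=> _ [tau gt ->]; rewrite DmE //; apply: cas_gperp.
(* Surjectivity of Cas on g^perp: an element orthogonal to the image is orthogonal to its own
   Casimir image, hence invariant, hence zero. *)
- have hT : subspace (fun y : T 2 => exists2 tau, gperp c tau & cas c tau = y).
    split.
      exists 0; first by case: gsub.
      by rewrite /cas big1 // => a _; rewrite big1 // => b _; rewrite !lact0 scaler0.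
    move=> a _ _ [x gx <-] [y gy <-]; exists (a *: x + y); first by case: gsub => _; apply.
    rewrite -!DmE //; last by case: gsub => _; apply.
    by rewrite grad_lin Dm_lin.
  have h := subspace_full (fun A B => @ipC R n c 2 A B) (@ip_lin R n c 2)
    (@ip_gt0 R n c hcompact 2) gsub hT.
  move=> y gy; have [_ [x gx <-]|z gz hz|tau gt e] := h _ _ y gy; last 1 first.
  + by exists (grad tau); split; [exists tau | rewrite DmE].
  + exact: cas_gperp.
  apply: (invariant_deg2 hlie hcompact); first by case/(gperp_del hlie hcompact): gz.
  by apply: (ip_cas_eq0 hlie hcompact); apply: hz; exists z.
- move=> _ [tau gt ->]; rewrite DmE // => /(cas0 _ gt) ->.
  apply: GT_ext => a; rewrite slice0 slice_raise big1 // => b _; by rewrite lact0 scaler0.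
- by move=> i x _; rewrite Dm_act lact_actk.
Qed.

(** The defining adjunction determines [x]: tested on x - delta beta, it makes the norm of that
    difference zero. *)
Lemma Lambda3_deltaP (x : T 3) :
  Lambda3_delta c x <-> exists2 beta : T 4, alt beta & x = del c beta.
Proof.
split=> [[beta [hb hx h]]|[beta hb ->]].
  exists beta => //; have hd := alt_del c hb; apply/eqP; rewrite -subr_eq0; apply/eqP.
  have ha := altB hx hd; apply: (ip_eq0 hcompact).
  have := h _ ha; rewrite (dgE hlie) // -!ip_ipk (ip_dif hlie hcompact) // => e.
  by rewrite ipBr e subrr.
exists beta; split=> // [|alpha ha]; first exact: alt_del.
by rewrite (dgE hlie) // -!ip_ipk (ip_dif hlie hcompact).
Qed.

Lemma Lambda3_delta_submod : submod (@actk R n c 3) (Lambda3_delta c).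
Proof.
split; first split.
- by apply/Lambda3_deltaP; exists 0; [case: (@alt_subspace R n 4) | rewrite delr0].
- move=> a x y /Lambda3_deltaP[b1 h1 ->] /Lambda3_deltaP[b2 h2 ->]; apply/Lambda3_deltaP.
  by exists (a *: b1 + b2); [apply: altD => //; apply: altZ | rewrite delD delZ].
move=> i x /Lambda3_deltaP[b hb ->]; apply/Lambda3_deltaP; exists (lact c i b).
  exact: alt_lact.
by rewrite -lact_actk (lact_del hlie hcompact).
Qed.

Definition psi (x : T 3) : GT := raise (fun b => coclosed_proj c (inn b x)).

Lemma ggperp_psi x : alt x -> ggperp c (psi x).
Proof.
move=> hx; apply: ggperp_raise => b; apply/(gperp_del hlie hcompact).
rewrite (del_coclosed_proj hlie hcompact); split=> //.
by apply/coclosed_proj_alt/alt_inn.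
Qed.

(** The sum of e^b /\ d i_b x splits by Cartan's formula into 2 d x from the Lie derivatives and -4
    d x from the degree count on d x, a form of degree 4. *)
Lemma Dp_psi x : alt x -> Dp (psi x) = 2 *: dif c x.
Proof.
move=> hx; rewrite Dp_raise; under eq_bigr do rewrite (dif_coclosed_proj hlie).
rewrite (eq_bigr (fun b => - wdg (dlt b) (lact c b x) - wdg (dlt b) (inn b (dif c x)))).
  rewrite sumrB sumrN (wdg_lact_dif hlie) // wdg_inn_degree; last exact: alt_dif.
  by tensor_ring.
move=> b _; rewrite inn_dif wdgB wdgN; tensor_ring.
Qed.

(** By Cartan's formula one part is a multiple of delta x = 0, the other contracts the symmetric
    metric with the alternating d x. *)
Lemma Dm_psi x : alt x -> del c x = 0 -> Dm (psi x) = 0.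
Proof.
move=> hx dx; rewrite Dm_raise.
rewrite (eq_bigr (fun a => - (\sum_b gi a b *: inn a (lact c b x))
   - \sum_b gi a b *: inn a (inn b (dif c x)))).
  rewrite sumrB sumrN (inn_lact_contract hlie) dx scaler0 inn_inn_contract; last exact: alt_dif.
  by rewrite !oppr0 addr0 oppr0.
move=> a _; rewrite -sumrN -sumrB; apply: eq_bigr => b _.
rewrite (dif_coclosed_proj hlie).
have -> : dif c (inn b x) = - lact c b x - inn b (dif c x) by rewrite inn_dif; tensor_ring.
by rewrite innB innN scalerBr scalerN.
Qed.

Lemma WperpMinus_Lambda3 : exists U : GT -> Prop,
  [/\ submod (actGT c) U, forall x, U x -> WperpMinus c x &
      gmod_iso (actGT c) (@actk R n c 3) U (Lambda3_delta c)].
Proof.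
have [Lsub Lact] := Lambda3_delta_submod.
have Lalt x : Lambda3_delta c x -> alt x by move=> [? []].
have Ldel x : Lambda3_delta c x -> del c x = 0.
  by move=> /Lambda3_deltaP[b hb ->]; apply: (del_del hlie hcompact).
have Ldd x : alt x -> Lambda3_delta c (del c (dif c x)).
  by move=> hx; apply/Lambda3_deltaP; exists (dif c x) => //; apply: alt_dif.
have ip_dd x : alt x -> ip c x (del c (dif c x)) = ip c (dif c x) (dif c x).
  by move=> hx; rewrite -(ip_dif hlie hcompact) //; apply: alt_dif.
(* The squared norm of delta b is the pairing of d delta b with [b]. *)
have dif0L x : Lambda3_delta c x -> dif c x = 0 -> x = 0.
  move=> /Lambda3_deltaP[b hb ->] e; apply: (ip_eq0 hcompact).
  by rewrite -(ip_dif hlie hcompact) //; [rewrite e ip0l | apply: alt_del].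
have [hg hW] := (ggperp_submod, Whar_submod).
have hP := submod_perp ipGT_lin ipGT_act hg hW.
have e2 : 2 != 0 :> R by rewrite pnatr_eq0.
(* Characterizing the submodule by the values of D_+ avoids naming the W_har component that has to
   be removed from [psi x]. *)
exists (fun P => WperpMinus c P /\ exists2 x, Lambda3_delta c x & Dp P = 2 *: dif c x); split.
- split; first split.
  + split; last first.
      exists 0; first by case: Lsub.
      by case/WharE: hW.1.1 => _ -> _; rewrite difr0 scaler0.
    case/WharE: hW.1.1 => g0 _ m0; apply/WperpMinusE; split=> // w _.
    exact: (form_0l ipGT_lin).
  + move=> a P Q [/WperpMinusE[gP mP hPw] [x Lx ex]] [/WperpMinusE[gQ mQ hQw] [y Ly ey]].
    split; last first.
      exists (a *: x + y); first by case: Lsub => _; apply.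
      by rewrite Dp_lin ex ey difD difZ scalerDr !scalerA mulrC.
    apply/WperpMinusE; split; first by case: hg.1 => _; apply.
      by rewrite Dm_lin mP mQ scaler0 addr0.
    by move=> w Ww; rewrite ipGT_lin hPw // hQw // mulr0 addr0.
  + move=> i P [/WperpMinusE[gP mP hPw] [x Lx ex]]; split; last first.
      exists (lact c i x); first by rewrite lact_actk; apply: Lact.
      by rewrite Dp_act ex lactZ (lact_dif hlie).
    have [gP' hP'] := hP.2 i P (conj gP hPw).
    by apply/WperpMinusE; split=> //; rewrite Dm_act mP lact0.
- by move=> P [].
exists (fun P => del c (Dp P)); split.
- by move=> a P Q; rewrite Dp_lin delD delZ.
- move=> P [_ [x Lx ->]]; rewrite delZ; apply: (subspaceZ _ Lsub); exact/Ldd/Lalt.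
(* Surjectivity of delta d on Lambda^3_delta: an element orthogonal to the image has d of norm zero,
   so [dif0L] applies. *)
- have hT : subspace (fun y : T 3 => exists2 x, Lambda3_delta c x & del c (dif c x) = y).
    split; first by exists 0; [case: Lsub | rewrite difr0 delr0].
    move=> a _ _ [x Lx <-] [y Ly <-]; exists (a *: x + y); first by case: Lsub => _; apply.
    by rewrite difD difZ delD delZ.
  have h := subspace_full (fun A B => @ipC R n c 3 A B) (@ip_lin R n c 3)
    (@ip_gt0 R n c hcompact 3) Lsub hT.
  move=> y Ly; have [_ [x Lx <-]|z Lz hz|x Lx e] := h _ _ y Ly; first exact/Ldd/Lalt.
    apply: dif0L => //; apply: (ip_eq0 hcompact); rewrite -ip_dd; last exact: Lalt.
    by apply: hz; exists z.
  have Lx2 : Lambda3_delta c (2^-1 *: x) by apply: subspaceZ.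
  have ax := Lalt _ Lx2.
  have [w Ww hw] := subspace_proj ipGTC ipGT_lin ipGT_gt0 (psi (2^-1 *: x)) hW.1.
  have /WharE[gw pw mw] := Ww.
  have eB P Q : P - Q = -1 *: Q + P by rewrite scaleN1r addrC.
  have eDp : Dp (psi (2^-1 *: x) - w) = 2 *: dif c (2^-1 *: x).
    by rewrite eB Dp_lin pw scaler0 add0r Dp_psi.
  exists (psi (2^-1 *: x) - w); split; last first.
    by rewrite eDp difZ scalerA mulfV // scale1r.
  split; last by exists (2^-1 *: x).
  apply/WperpMinusE; split.
  + by apply: (subspaceB hg.1) => //; apply: ggperp_psi.
  + by rewrite eB Dm_lin mw scaler0 add0r Dm_psi // Ldel.
  + by move=> v; apply: hw.
- move=> P [/WperpMinusE[gP mP hPw] [x Lx ex]]; rewrite ex delZ => /eqP.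
  rewrite scaler_eq0 (negPf e2) /= => /eqP dd.
  have dx : dif c x = 0.
    by apply: (ip_eq0 hcompact); rewrite -ip_dd ?dd ?ip0r //; apply: Lalt.
  (* With d x = 0 both D_+ and D_- vanish on [P], so [P] lies in W_har and is orthogonal to it. *)
  apply: (form_eq0 ipGT_gt0); apply: hPw; apply/WharE; split=> //.
  by rewrite ex dx scaler0.
- by move=> i P _; rewrite Dp_act -(lact_del hlie hcompact) lact_actk.
Qed.

End TensorProduct.

Unset Implicit Arguments.

Theorem theorem4p8 (R : rcfType) (n : nat) (c : 'I_n -> 'I_n -> 'I_n -> R)
  (hlie : is_lie_algebra c) (hcompact : is_compact c) (hsimple : is_simple c)
  (hdim : (8 <= n)%N) :
  (* (1) g (x) g^perp = W_har (+) (+)_i V_i, V_i irreducible, each isomorphic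
         to an irreducible submodule of Lambda^2 g (+) Lambda^4 g *)
  [/\ (exists (m : nat) (V : 'I_m -> GT R n -> Prop),
        [/\ forall i, [/\ irreducible (actGT c) (V i),
                           forall x, V i x -> ggperp c x &
                           exists U : L24 R n -> Prop,
                             [/\ irreducible (act24 c) U,
                                 forall p, U p -> inL24 p &
                                 gmod_iso (actGT c) (act24 c) (V i) U]],
            forall x, ggperp c x <->
              exists (w : GT R n) (v : 'I_m -> GT R n),
                [/\ Whar c w, forall i, V i (v i) & x = w + \sum_i v i] &
            forall (w : GT R n) (v : 'I_m -> GT R n),
              Whar c w -> (forall i, V i (v i)) -> w + \sum_i v i = 0 ->
              w = 0 /\ forall i, v i = 0]),
   (* (2) *)
   (exists U : GT R n -> Prop,
      [/\ submod (actGT c) U, forall x, U x -> WperpPlus c x &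
          gmod_iso (actGT c) (@actk R n c 2) U (gperp c)]),
   (* (3) *)
   (exists U : GT R n -> Prop,
      [/\ submod (actGT c) U, forall x, U x -> WperpMinus c x &
          gmod_iso (actGT c) (@actk R n c 3) U (Lambda3_delta c)]),
   (* (4) omega_g /\ Lambda^1 g is contained in the image of D_+ *)
   (forall theta : Tens R n 1, exists x, ggperp c x /\
        Dplus c x = wedge (omega c) theta) &
   (* (5) D_- : g (x) g^perp -> Lambda^2 g is onto *)
   (forall beta : Tens R n 2, alt beta -> exists x, ggperp c x /\
        Dminus c x = beta)].
Proof.
(* Makes the factor n - 3 of [twisted_invariant] invertible. *)
have n3 : n != 3 by apply: contraTneq hdim => ->.
split.
- exact: decomposition.
- exact: WperpPlus_gperp.
- exact: WperpMinus_Lambda3.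
- exact: Dplus_omega.
- exact: Dminus_surjective.
Qed.
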